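(* Let $F$ be a fixed graph with at least one edge, and put \[ p^*=p^*(n)=N^{-1/\rho^{\max}(F)}\sqrt{\ln N}. \] Then $p^*$ is a threshold probability for the property ''$G_p$ contains a copy of $F$'': if $p=o(p^* )$ then $\Pr(G_p \text{ contains a copy of } F)\to 0$ as $n\to\infty$, and if $p/p^*\to\infty$ then $\Pr(G_p \text{ contains a copy of } F)\to 1$. Moreover, if $p/p^*\to\infty$, then for every $\varepsilon>0$, \[ \Pr\left(\left|\frac{X_F}{\mathbb{E} X_F}-1\right|<\varepsilon\right)\to 1 \quad (n\to\infty), \] where $X_F$ is the number of copies of $F$ in $G_p$.
   Context: Throughout, $n$ ranges over positive integers divisible by $4$ and asymptotics are as $n\to\infty$. The complete distance graph $G=G(n,n/2,n/4)=(V,E)$ has vertex set $V=\{\mathbf{x}=(x_1,\dots,x_n)\in\{0,1\}^n : x_1+\dots+x_n=n/2\}$ and edge set $E=\{\{\mathbf{x},\mathbf{y}\}: \langle \mathbf{x},\mathbf{y}\rangle=n/4\}$, where $\langle\cdot,\cdot\rangle$ is the Euclidean inner product. Let $N=|V|=\binom{n}{n/2}$ and $N_1=\binom{n/2}{n/4}^2$ (the common degree of vertices of $G$). The random distance graph $G_p=G_p(n,n/2,n/4)$, $p=p(n)\in[0,1]$, is the random spanning subgraph of $G$ in which each edge of $G$ is kept independently with probability $p$. For a graph $H$ with $v(H)$ vertices and $e(H)$ edges, $\rho(H)=e(H)/v(H)$, and the maximal density of $F$ is $\rho^{\max}(F)=\max\{e(H)/v(H): H\subseteq F,\ v(H)\neq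 0\}$. *)

(* Defs.v *)
From HB Require Import structures.
From mathcomp Require Import all_boot all_order all_algebra.
From mathcomp Require Import all_classical all_reals all_analysis.

Set Implicit Arguments.
Unset Strict Implicit.
Unset Printing Implicit Defensive.

Import Order.TTheory GRing.Theory Num.Theory.
Local Open Scope ring_scope.

Section DistanceGraph.
Variable n : nat.

Definition cube := {ffun 'I_n -> bool}.

Definition ip (x y : cube) : nat := #|[set i : 'I_n | x i && y i]|.

Definition Vdg : {set cube} := [set x : cube | #|[set i : 'I_n | x i]| == n %/ 2]%N.

Definition Edg : {set {set cube}} :=
  [set s : {set cube} | [exists x : cube, exists y : cube,
     [&& x \in Vdg, y \in Vdg, (ip x y == n %/ 4)%N & s == [set x; y]]]].

Definition Nn : nat := 'C(n, n %/ 2)%N.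
End DistanceGraph.

Section Pattern.
Variables (T : finType) (e : rel T).

Definition edgesF : {set {set T}} :=
  [set s : {set T} | [exists a : T, exists b : T, e a b && (s == [set a; b])]].

Definition subgraphF (H : {set T} * {set {set T}}) : bool :=
  [&& (0 < #|H.1|)%N, H.2 \subset edgesF & [forall s in H.2, s \subset H.1]].

Definition rho_max (R : realType) : R :=
  \big[Num.max/0]_(H | subgraphF H) ((#|H.2|)%:R / (#|H.1|)%:R).

Definition is_copy (n : nat) (S : {set {set cube n}})
    (H : {set cube n} * {set {set cube n}}) : bool :=
  [&& H.1 \subset Vdg n, H.2 \subset S &
   [exists f : {ffun T -> cube n},
      [&& injectiveb f, f @: [set: T] == H.1 &
          H.2 == [set [set f ab.1; f ab.2] | ab in [set ab : T * T | e ab.1 ab.2]]]]].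

Definition XF (n : nat) (S : {set {set cube n}}) : nat :=
  #|[set H | is_copy S H]|.

Definition contains_copy (n : nat) (S : {set {set cube n}}) : bool :=
  [exists H, is_copy S H].
End Pattern.

Section RandomGraph.
Variable R : realType.

(* probability that the random spanning subgraph G_p(n,n/2,n/4) has edge set S *)
Definition wG (n : nat) (p : R) (S : {set {set cube n}}) : R :=
  p ^+ #|S| * (1 - p) ^+ (#|Edg n| - #|S|).

Definition PrG (n : nat) (p : R) (P : {set {set cube n}} -> bool) : R :=
  \sum_(S in finset.powerset (Edg n) | P S) wG p S.

Definition EG (n : nat) (p : R) (X : {set {set cube n}} -> R) : R :=
  \sum_(S in finset.powerset (Edg n)) wG p S * X S.

Definition pstar (T : finType) (e : rel T) (n : nat) : R :=
  (Nn n)%:R `^ (- (rho_max e R)^-1) * Num.sqrt (ln ((Nn n)%:R)).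
End RandomGraph.

Arguments PrG {R} n p P.
Arguments EG {R} n p X.
Arguments XF {T} e {n} S.
Arguments contains_copy {T} e {n} S.
Arguments pstar R {T} e n.

(* Main.v *)
(* Encode a tuple of vertices (x_a)_(a in T) of the cube by its transpose, a
   colouring of [n] by subsets of T; K = 2^|T| colours.  Being an embedding of a
   graph (T, E) prescribes, for each singleton and each edge B, the number of
   coordinates whose colour contains B.  With s ~ sqrt n, the number of embeddings
   is of order K^n / s^(|T| + |E|).  Both bounds compare multinomial coefficients:
   - upper bound: by log-concavity, a type (vector of colour multiplicities) m with
     all entries of order n satisfies f(m) <= C (f(m + d) + f(m - d)) for shifts
     d = O(s); the s^(|T| + |E|) shifts used here change the prescribed numbers in
     pairwise different ways, so the shifted families are disjoint; types with a
     small entry are exponentially rare;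
   - lower bound: by Chebyshev's inequality half of the colourings have all
     multiplicities within O(s) of n / K, hence at most O(s)^(|T| + |E|) vectors of
     prescribed numbers occur; each of these fibres is shifted, at the price of a
     constant, onto the wanted vector, which is attained by an explicit type when
     4 | n.
   Since N ~ 2^n / s and sqrt (ln N) ~ s, the expected number of copies of a graph
   with v vertices and e edges is of order N^v (p / sqrt (ln N))^e.  The threshold
   then follows from the first moment of a densest subgraph and from Chebyshev's
   inequality, where two overlapping copies are embeddings of their union. *)
Require Import Defs.
From HB Require Import structures.
From mathcomp Require Import all_boot all_order all_algebra.
From mathcomp Require Import all_classical all_reals all_analysis.
From mathcomp Require Import zify ring lra.
From mathcomp Require Import fintype finset.
Set Implicit Arguments.
Unset Strict Implicit.
Unset Printing Implicit Defensive.
Import Order.TTheory GRing.Theory Num.Theory numFieldNormedType.Exports.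
Local Open Scope ring_scope.

(** * Bernoulli weights on the subsets of a finite set *)

Section SubsetWeights.
Variables (R : comPzRingType) (X : finType).
Implicit Types (A E S : {set X}) (p : R).

Lemma sum_subset_weight E p :
  \sum_(S in powerset E) p ^+ #|S| * (1 - p) ^+ (#|E| - #|S|) = 1.
Proof.
transitivity (\sum_(k < #|E|.+1) ((1 - p) ^+ (#|E| - k) * p ^+ k) *+ 'C(#|E|, k)).
  rewrite (partition_big (fun S => inord #|S| : 'I_#|E|.+1) predT) //=.
  apply: eq_bigr => k _.
  rewrite -cards_draws -sumr_const.
  rewrite [LHS](eq_bigl (mem [set S : {set X} | (S \subset E) & #|S| == k])) /=; last first.
    move=> S; rewrite !inE; case: (boolP (S \subset E)) => //= sSE.
    by rewrite -val_eqE /= inordK // ltnS subset_leq_card.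
  by apply: eq_bigr => S; rewrite !inE => /andP[_ /eqP ->]; rewrite mulrC.
by rewrite -exprDn subrK expr1n.
Qed.

(** The supersets of [A] inside [E] are the sets [A :|: S] with [S \subset E :\: A]; the factor
    [p ^+ #|A|] comes out and the remaining weights sum to 1. *)
Lemma sum_superset_weight E A p : A \subset E ->
  \sum_(S in powerset E | A \subset S) p ^+ #|S| * (1 - p) ^+ (#|E| - #|S|)
    = p ^+ #|A|.
Proof.
move=> sAE.
rewrite -[RHS]mulr1 -[in RHS](sum_subset_weight (E :\: A) p) mulr_sumr.
rewrite (reindex_onto (fun S => A :|: S) (fun S => S :\: A)) /=; last first.
  move=> S /andP[_ /subsetP sAS]; apply/setP => x; rewrite !inE.
  by have := sAS x; case: (x \in A) => //= ->.
rewrite [LHS](eq_bigl (mem (powerset (E :\: A)))); last first.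
  move=> S; rewrite !inE subsetUl andbT subUset sAE /= subsetD; congr andb.
  rewrite setDUl setDv set0U.
  by apply/eqP/idP => [<-|/setDidPl //]; rewrite disjoints_subset subsetDr.
apply: eq_bigr => S; rewrite /= inE subsetD => /andP[sSE dSA].
have cU : #|A :|: S| = (#|A| + #|S|)%N.
  by rewrite cardsU disjoint_setI0 1?disjoint_sym // cards0 subn0.
rewrite cU subnDA exprD -mulrA; congr (_ * (_ * _ ^+ _)).
by rewrite cardsD (setIidPr sAE).
Qed.

End SubsetWeights.

(** * Colourings of given type *)

Section ColourClasses.
Variable (Omega : finType).

Section Fixed.
Variable n : nat.
Implicit Types (c : {ffun 'I_n -> Omega}) (mu : Omega -> int).

(** Integer-valued, so that types can be shifted by signed vectors; a type with a negative entry has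
    an empty class. *)
Definition colour_count c A : int := \sum_i (c i == A)%:Z.

Definition colour_class mu := [set c | [forall A, colour_count c A == mu A]].

Lemma colour_classP c mu : reflect (colour_count c =1 mu) (c \in colour_class mu).
Proof. by rewrite inE; apply: (iffP forallP) => h A; apply/eqP. Qed.

Lemma colour_count_ge0 c A : 0 <= colour_count c A.
Proof. by apply: sumr_ge0 => i _. Qed.

Lemma sum_colour_count c : \sum_A colour_count c A = n%:Z.
Proof.
rewrite exchange_big /= (eq_bigr (fun=> 1)); last first.
  move=> i _; rewrite (bigD1 (c i)) //= eqxx big1 ?addr0 // => A.
  by rewrite eq_sym => /negPf ->.
by rewrite sumr_const card_ord; lia.
Qed.

End Fixed.

Section Cons.
Variable n : nat.

Definition colour_cons (x : Omega * {ffun 'I_n -> Omega}) : {ffun 'I_n.+1 -> Omega} :=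
  [ffun i => if unlift ord0 i is Some j then x.2 j else x.1].

Lemma colour_cons_bij : bijective colour_cons.
Proof.
exists (fun c : {ffun 'I_n.+1 -> Omega} => (c ord0, [ffun j => c (lift ord0 j)])) => [[A c]|c].
  congr (_, _); first by rewrite ffunE unlift_none.
  by apply/ffunP => j; rewrite !ffunE liftK.
by apply/ffunP => i; rewrite !ffunE; case: unliftP => [j ->|-> //]; rewrite ffunE.
Qed.

Lemma sum_colour_cons (V : nmodType) (F : {ffun 'I_n.+1 -> Omega} -> V) :
  \sum_c F c = \sum_A \sum_c F (colour_cons (A, c)).
Proof.
by rewrite pair_big (reindex colour_cons) /=; [apply: eq_bigr => -[] | apply/onW_bij/colour_cons_bij].
Qed.

Lemma big_colour_cons (V : nmodType) (G : Omega -> V) A c :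
  \sum_i G (colour_cons (A, c) i) = G A + \sum_i G (c i).
Proof.
rewrite big_ord_recl; congr (G _ + _); first by rewrite ffunE unlift_none.
by apply: eq_bigr => j _; rewrite ffunE liftK.
Qed.

End Cons.

(** The multinomial formula, by induction on [n]: deleting the first coordinate, of colour [A],
    lowers [mu A] by one. *)
Lemma card_colour_class (n : nat) (mu : Omega -> int) :
  (forall A, 0 <= mu A) -> \sum_A mu A = n%:Z ->
  (#|@colour_class n mu| * \prod_A (absz (mu A))`! = n`!)%N.
Proof.
elim: n mu => [|n IHn] mu mu0 smu.
  have mu0E A : mu A = 0.
    by apply: (psumr_eq0P (fun A _ => mu0 A) smu).
  rewrite big1 ?muln1; last by move=> A _; rewrite mu0E.
  rewrite fact0 -[RHS](_ : #|{ffun 'I_0 -> Omega}| = 1)%N; last by rewrite card_ffun card_ord.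
  by apply: eq_card => c; rewrite inE; apply/forallP => A; rewrite mu0E /colour_count big_ord0.
pose dec A B := mu B - (A == B)%:Z.
have -> : #|@colour_class n.+1 mu| = (\sum_A #|@colour_class n (dec A)|)%N.
  rewrite -sum1_card big_mkcond sum_colour_cons; apply: eq_bigr => A _.
  rewrite -sum1_card [RHS]big_mkcond; apply: eq_bigr => c _.
  congr (if _ then _ else _); rewrite !inE; apply: eq_forallb => B.
  rewrite /colour_count (@big_colour_cons _ _ (fun A => (A == B)%:Z)) /dec.
  by rewrite [RHS]eq_sym subr_eq eq_sym addrC.
rewrite big_distrl /= factS.
have -> : (n.+1 * n`! = \sum_A absz (mu A) * n`!)%N.
  rewrite -big_distrl /=; congr (_ * _)%N; apply/eqP; rewrite -eqz_nat -smu.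
  rewrite (eq_bigr (fun A => (absz (mu A))%:Z)) => [|A _]; last by rewrite gez0_abs.
  by rewrite -(big_morph Posz PoszD (erefl _)).
apply: eq_bigr => A _.
(* If [mu A = 0], then [dec A A = -1], so the class of [dec A] is empty and both summands vanish. *)
have [muA0|muAN0] := eqVneq (mu A) 0.
  rewrite muA0 mul0n eq_card0 ?mul0n // => c; rewrite inE; apply/forallP => /(_ A).
  by rewrite /dec eqxx muA0 => /eqP cA; have := colour_count_ge0 c A; rewrite cA.
have muA1 : 1 <= mu A by rewrite -gtz0_ge1 lt_neqAle eq_sym muAN0 mu0.
rewrite -(IHn (dec A)); last first.
- rewrite sumrB smu (bigD1 A) //= eqxx big1 => [|B]; last by rewrite eq_sym => /negPf ->.
  by lia.
- by move=> B; rewrite /dec; case: eqP => [<-|_]; [lia | rewrite subr0].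
rewrite mulnCA; congr (_ * _)%N.
rewrite (bigD1 A) //= [in RHS](bigD1 A) //= mulnA; congr (_ * _)%N.
  rewrite /dec eqxx; case: (mu A) muA1 => // -[//|a] _.
  by rewrite factS; congr (_ * _`!)%N; lia.
by apply: eq_bigr => B; rewrite eq_sym /dec => /negPf ->; rewrite subr0.
Qed.

End ColourClasses.

(** * Ratios of multinomial coefficients *)

Section ClassRatio.
Variable R : realType.

(** For [x <= y], the quotient of the factorials has [y - x] factors, all at most [y]; for [y < x],
    its inverse has [x - y] factors, all at least [y]. The exponential form covers both signs of the
    difference. *)
Lemma fact_le_expR_ln (x y : nat) : (0 < y)%N ->
  (y`!)%:R <= (x`!)%:R * expR ((y%:R - x%:R) * ln y%:R) :> R.
Proof.
move=> y0; have yR0 : 0 < y%:R :> R by rewrite ltr0n.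
have expRln d : expR (d%:R * ln y%:R) = y%:R ^+ d :> R.
  by rewrite expRM_natl lnK.
have [xy|yx] := leqP x y.
  rewrite -natrB // expRln -natrX -natrM ler_nat.
  rewrite -{1 2}(subnKC xy); move: (y - x)%N => d.
  elim: d => [|d IHd]; first by rewrite addn0 muln1.
  rewrite addnS factS expnS mulnCA leq_mul2l /=.
  apply: leq_trans IHd _; rewrite leq_mul2l; apply/orP; right.
  by case: d => // d; rewrite leq_exp2r.
rewrite -opprB mulNr expRN -natrB ?(ltnW yx) // expRln.
rewrite ler_pdivlMr ?exprn_gt0 // -natrX -natrM ler_nat.
rewrite -[in leqRHS](subnKC (ltnW yx)); move: (x - y)%N => d.
elim: d => [|d IHd]; first by rewrite addn0 muln1.
by rewrite addnS factS expnS mulnCA leq_mul // leqW // leq_addr.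
Qed.

Variables (Omega : finType) (n : nat).
Implicit Types (mu nu : Omega -> int).

Local Notation f mu := (#|@colour_class Omega n mu|%:R : R).

Lemma colour_class_ratio mu nu :
  (forall A, 0 <= mu A) -> \sum_A mu A = n%:Z ->
  (forall A, 0 < nu A) -> \sum_A nu A = n%:Z ->
  f mu <= f nu * expR (\sum_A (nu A - mu A)%:~R * ln (nu A)%:~R).
Proof.
move=> mu0 smu nu0 snu.
have nu0' A : 0 <= nu A by apply: ltW.
have fE := card_colour_class mu0 smu; have := card_colour_class nu0' snu.
rewrite -fE => /(congr1 (fun k => k%:R : R)); rewrite !natrM => e.
have P0 : 0 < \prod_A ((absz (mu A))`!)%:R :> R.
  by apply: prodr_gt0 => A _; rewrite ltr0n fact_gt0.
rewrite -(ler_pM2r P0) -natr_prod -e -mulrA ler_wpM2l //.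
rewrite expR_sum !natr_prod -big_split /=; apply: ler_prod => A _.
rewrite ler0n mulrC /=.
have := @fact_le_expR_ln (absz (mu A)) (absz (nu A)); rewrite absz_gt0 gt_eqF // => /(_ isT).
by rewrite !natr_absz !ger0_norm // intrB.
Qed.

End ClassRatio.

(** * Shifting families of colourings *)

Section Shift.
Variables (R : realType) (Omega : finType) (n : nat).
Implicit Types (c : {ffun 'I_n -> Omega}) (P Q : {set {ffun 'I_n -> Omega}}).
Implicit Types (mu d : Omega -> int).

Local Notation f mu := (#|@colour_class Omega n mu|%:R : R).
Local Notation ty := (@colour_count Omega n).

Lemma class_of_count c : c \in colour_class n (ty c).
Proof. exact/colour_classP. Qed.

(* Double counting: each [c] spreads the mass [1 / f (ty c)] over the class of [ty c + d]. *)
Lemma sum_shift_ratio_le P Q d :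
  (forall c c', c \in P -> ty c' =1 (fun A => ty c A + d A) -> c' \in Q) ->
  \sum_(c in P) f (fun A => ty c A + d A) / f (ty c) <= #|Q|%:R.
Proof.
move=> PQ.
have -> : \sum_(c in P) f (fun A => ty c A + d A) / f (ty c) =
   \sum_(c in P) \sum_(c' in colour_class n (fun A => ty c A + d A)) (f (ty c))^-1.
  by apply: eq_bigr => c _; rewrite sumr_const mulr_natl.
rewrite (exchange_big_dep (mem Q)) /=; last first.
  by move=> c c' cP /colour_classP; apply: PQ.
rewrite -sum1_card natr_sum; apply: ler_sum => c' _.
pose Z := colour_class n (fun A => ty c' A - d A) : {set {ffun 'I_n -> Omega}}.
have ZE c : c' \in colour_class n (fun A => ty c A + d A) -> c \in Z /\ f (ty c) = #|Z|%:R.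
  move=> /colour_classP h; have cE : ty c =1 (fun A => ty c' A - d A) by move=> A; rewrite h addrK.
  split; first exact/colour_classP.
  congr (_%:R); apply: eq_card => x; apply/colour_classP/colour_classP => e A.
    by rewrite e cE.
  by rewrite e cE.
apply: (@le_trans _ _ (\sum_(c in Z) (#|Z|%:R)^-1)).
  rewrite [leLHS]big_mkcond [leRHS]big_mkcond /=; apply: ler_sum => c _.
  case: ifP => [/andP[_ /ZE[-> ->]] //|_].
  by case: ifP => // _; rewrite invr_ge0.
rewrite sumr_const -[_ *+ _]mulr_natl.
by have [->|/divff -> //] := eqVneq (#|Z|%:R : R) 0; rewrite mul0r ler01.
Qed.

(** Dividing the pointwise bound by [f (ty c)] and summing over [P] leaves two transported masses,
    bounded by [#|Q1|] and [#|Q2|]. Two shifts appear because log-concavity controls only a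
    symmetric pair; the lower bound takes [d1 = d2]. *)
Lemma card_le_shift P Q1 Q2 d1 d2 (C : R) : 0 <= C ->
  (forall c, c \in P ->
     f (ty c) <= C * (f (fun A => ty c A + d1 A) + f (fun A => ty c A + d2 A))) ->
  (forall c c', c \in P -> ty c' =1 (fun A => ty c A + d1 A) -> c' \in Q1) ->
  (forall c c', c \in P -> ty c' =1 (fun A => ty c A + d2 A) -> c' \in Q2) ->
  #|P|%:R <= C * (#|Q1|%:R + #|Q2|%:R).
Proof.
move=> C0 fC PQ1 PQ2.
apply: (@le_trans _ _ (C * (\sum_(c in P) f (fun A => ty c A + d1 A) / f (ty c)
    + \sum_(c in P) f (fun A => ty c A + d2 A) / f (ty c)))); last first.
  by apply: ler_wpM2l => //; apply: lerD; apply: sum_shift_ratio_le.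
rewrite -big_split /= mulr_sumr -sum1_card natr_sum; apply: ler_sum => c cP.
have fc0 : 0 < f (ty c) by rewrite ltr0n; apply/card_gt0P; exists c; apply: class_of_count.
by rewrite -mulrDl mulrA ler_pdivlMr // mul1r fC.
Qed.

End Shift.

(** * Upper bound for the number of colourings with prescribed superset counts *)

Section LogBounds.
Variable R : realType.

Lemma ln_sub_le (L x y : R) : 0 < L -> L <= x -> L <= y -> ln x - ln y <= `|x - y| / L.
Proof.
move=> L0 Lx Ly; have x0 := lt_le_trans L0 Lx; have y0 := lt_le_trans L0 Ly.
rewrite -ln_div ?posrE // -[x / y](subrK 1) [_ - 1 + 1]addrC.
have -> : x / y - 1 = (x - y) / y by rewrite mulrBl divff ?gt_eqF.
apply: (@le_trans _ _ ((x - y) / y)).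
  by apply: le_ln1Dx; rewrite mulrBl divff ?gt_eqF // ltrBDl subrr divr_gt0.
apply: (@le_trans _ _ (`|x - y| / y)).
  by rewrite ler_wpM2r ?invr_ge0 ?(ltW y0) // ler_norm.
by rewrite ler_wpM2l // lef_pV2 ?posrE.
Qed.

Lemma mul_ln_sub_le (L d x y : R) : 0 < L -> L <= x -> L <= y ->
  d * (ln x - ln y) <= `|d| * `|x - y| / L.
Proof.
move=> L0 Lx Ly; apply: le_trans (ler_norm _) _; rewrite normrM -mulrA.
apply: ler_wpM2l => //; rewrite ler_norml lerNl opprB ln_sub_le // andbT.
by rewrite distrC ln_sub_le.
Qed.

Lemma expRN_le_fact (x : R) j : 0 < x -> expR (- x) <= (j.+1)`!%:R / x ^+ j.+1.
Proof.
move=> x0; rewrite expRN -[leRHS]invf_div lef_pV2 ?posrE ?expR_gt0 //; last first.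
  by rewrite divr_gt0 ?exprn_gt0 // ltr0n fact_gt0.
by apply: le_trans (expR_ge1Dxn j (ltW x0)); rewrite lerDr.
Qed.

(** Bernoulli's inequality gives (1 + 1/M)^M >= 2. *)
Lemma two_expn_le (M a n : nat) : (0 < M)%N -> (M * a <= n)%N ->
  2 ^+ a <= (1 + M%:R^-1) ^+ n :> R.
Proof.
move=> M0 Man; have h : 0 <= M%:R^-1 :> R by rewrite invr_ge0.
apply: (@le_trans _ _ ((1 + M%:R^-1) ^+ (M * a))); last first.
  by rewrite ler_weXn2l ?lerDl.
rewrite exprM lerXn2r ?nnegrE ?exprn_ge0 ?addr_ge0 //.
have bern k : 1 + k%:R / M%:R <= (1 + M%:R^-1) ^+ k :> R.
  elim: k => [|k IHk]; first by rewrite mul0r addr0 expr0.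
  rewrite exprS; apply: (@le_trans _ _ ((1 + M%:R^-1) * (1 + k%:R / M%:R))); last first.
    by rewrite ler_wpM2l // addr_ge0.
  have := mulr_ge0 (mulr_ge0 (ler0n R k) h) h; rewrite -natr1.
  by set u := M%:R^-1; lra.
by apply: le_trans (bern M); rewrite divff ?pnatr_eq0 -?lt0n.
Qed.

End LogBounds.

(** * Exponential rarity of colourings with an infrequent colour *)

Section Chernoff.
Variables (R : realType) (Omega : finType).

Lemma colour_countE n (c : {ffun 'I_n -> Omega}) A :
  colour_count c A = (#|[set i | c i == A]|)%:Z.
Proof.
rewrite -sum1_card big_mkcond /= (big_morph Posz PoszD (erefl _)).
by apply: eq_bigr => i _; rewrite inE; case: eqP.
Qed.

(** Chernoff's method: let each occurrence of [A] weigh 1/2. A colouring in the set weighs at least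
    2^(-a), while the total weight factorises into (K - 1/2)^n. *)
Lemma card_rare_colour n a A :
  (#|[set c : {ffun 'I_n -> Omega} | colour_count c A <= a%:Z]|)%:R
    <= 2 ^+ a * (#|Omega|%:R - 2^-1) ^+ n :> R.
Proof.
pose g w : R := if w == A then 2^-1 else 1.
have sg : \sum_w g w = #|Omega|%:R - 2^-1.
  rewrite (bigD1 A) //= /g eqxx (eq_bigr (fun=> 1)) => [|w /negPf -> //].
  rewrite sumr_const cardC1 -[#|Omega|](@prednK _) ?natr1; first lra.
  by apply/card_gt0P; exists A.
have -> : (#|Omega|%:R - 2^-1) ^+ n = \sum_(c : {ffun 'I_n -> Omega}) \prod_i g (c i) :> R.
  by rewrite -(bigA_distr_bigA (fun _ w => g w)) /= prodr_const card_ord sg.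
rewrite -sum1_card natr_sum big_mkcond mulr_sumr; apply: ler_sum => c _.
have -> : \prod_i g (c i) = 2^-1 ^+ #|[set i | c i == A]|.
  rewrite -prodr_const [RHS]big_mkcond; apply: eq_bigr => i _.
  by rewrite inE.
rewrite inE colour_countE lez_nat; case: ifP => h.
  by rewrite exprVn ler_pdivlMr ?exprn_gt0 // mul1r ler_weXn2l // ler1n.
by rewrite mulr_ge0 ?exprn_ge0 // invr_ge0.
Qed.

Lemma rare_colour_negligible (b : nat) : exists C : R, 0 < C /\
  forall (n s a : nat) A, (0 < n)%N -> (s ^ 2 <= n)%N -> (4 * #|Omega| * a <= n)%N ->
  (#|[set c : {ffun 'I_n -> Omega} | colour_count c A <= a%:Z]|)%:R * s%:R ^+ b
    <= C * #|Omega|%:R ^+ n.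
Proof.
have [K0|K0] := posnP #|Omega|.
  exists 1; split=> // n s a A; have: A \in Omega by [].
  by move/card0_eq: K0 => ->.
pose K : R := #|Omega|%:R; have KR0 : 0 < K by rewrite ltr0n.
pose D : R := (b.+1)`!%:R * (4 * K) ^+ b.+1.
have D0 : 0 < D by rewrite mulr_gt0 ?exprn_gt0 ?mulr_gt0 // ltr0n fact_gt0.
exists D; split => // n s a A n0 sn an; have nR0 : 0 < n%:R :> R by rewrite ltr0n.
have K1 : 1 <= K by rewrite ler1n.
set x : R := n%:R / (4 * K).
have x0 : 0 < x by rewrite divr_gt0 ?mulr_gt0.
have step1 : (#|[set c : {ffun 'I_n -> Omega} | colour_count c A <= a%:Z]|)%:R
    <= K ^+ n * expR (- x).
  apply: le_trans (card_rare_colour _ _ _) _; rewrite -/K.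
  have KK : 0 <= K - 2^-1 by lra.
  apply: (@le_trans _ _ ((1 + (4 * #|Omega|)%:R^-1) ^+ n * (K - 2^-1) ^+ n)).
    by rewrite ler_wpM2r ?exprn_ge0 // two_expn_le // muln_gt0.
  rewrite /x -mulrN.
  have -> : expR (n%:R * - (4 * K)^-1) = expR (- (4 * K)^-1) ^+ n by rewrite expRM_natl.
  have iK0 : 0 < (4 * K)^-1 by rewrite invr_gt0 mulr_gt0.
  rewrite natrM -/K -!exprMn; apply: lerXn2r; rewrite ?nnegrE.
  - by rewrite mulr_ge0 // addr_ge0 // ltW.
  - by rewrite mulr_ge0 ?expR_ge0 // ltW.
  (* Per coordinate: (1 + 1/4K)(K - 1/2) <= K - 1/4 = K(1 - 1/4K) <= K exp(-1/4K). The resulting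
     factor exp(-n/4K) then absorbs any fixed power of [s <= n]. *)
  apply: (@le_trans _ _ (K * (1 - (4 * K)^-1))); last first.
    by rewrite ler_wpM2l ?(ltW KR0) // expR_ge1Dx.
  have e : K * (4 * K)^-1 = 4^-1 by field; lra.
  by move: (4 * K)^-1 iK0 e => u u0 e; lra.
apply: (@le_trans _ _ (K ^+ n * expR (- x) * s%:R ^+ b)).
  by rewrite ler_wpM2r ?exprn_ge0.
rewrite -mulrA [leRHS]mulrC ler_pM2l ?exprn_gt0 //.
apply: (@le_trans _ _ (((b.+1)`!%:R / x ^+ b.+1) * n%:R ^+ b.+1)).
  apply: ler_pM; rewrite ?expR_ge0 ?exprn_ge0 ?expRN_le_fact //.
  rewrite -!natrX ler_nat; apply: (@leq_trans (n ^ b)); last by rewrite leq_pexp2l.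
  have : (s <= n)%N by nia.
  by case: (b) => // b' ?; rewrite leq_exp2r.
have nE : n%:R = x * (4 * K) by rewrite /x divfK // gt_eqF // mulr_gt0.
by clearbody x; rewrite nE exprMn mulrA divfK // expf_neq0 // gt_eqF.
Qed.

End Chernoff.

Lemma sum_card_disjoint (I X : finType) (D : {pred I}) (Q : I -> {set X}) :
  (forall i j x, i \in D -> j \in D -> x \in Q i -> x \in Q j -> i = j) ->
  (\sum_(i in D) #|Q i| <= #|X|)%N.
Proof.
move=> disj; under eq_bigr do rewrite -sum1_card big_mkcond /=.
rewrite exchange_big /= -sum1_card; apply: leq_sum => x _.
rewrite -big_mkcondr sum1_card; apply/card_le1_eqP => i j.
by rewrite !unfold_in => /andP[iD xi] /andP[jD xj]; apply: disj xj xi.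
Qed.

Lemma card_le_sum_exceptions (I X : finType) (S P : {set X}) (bad : I -> {set X}) :
  (forall x, x \in S -> x \in P \/ exists i, x \in bad i) ->
  (#|S| <= #|P| + \sum_i #|bad i|)%N.
Proof.
have cE (A : {set X}) : #|A| = (\sum_x (x \in A : nat))%N.
  by rewrite -sum1_card big_mkcond; apply: eq_bigr => x _; case: (x \in A).
move=> h; rewrite !cE (eq_bigr _ (fun i _ => cE (bad i))) exchange_big -big_split /=.
apply: leq_sum => x _; case: (boolP (x \in S)) => // xS.
have [->|[i xi]] := h _ xS; first by rewrite leq_addr.
by rewrite [X in (_ <= _ + X)%N](bigD1 i) //= xi addnCA leq_addr.
Qed.

(** * Superset sums of integer functions on a power set *)

Section SupersetSums.
Variable (T : finType).
Implicit Types (A B : {set T}) (d : {set T} -> int).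

(** The zeta transform of the subset lattice; on the type of a colouring it counts the coordinates
    whose colour contains [B]. *)
Definition superset_sum d B : int := \sum_(A : {set T} | B \subset A) d A.

Lemma superset_sumD d1 d2 B :
  superset_sum (fun A => d1 A + d2 A) B = superset_sum d1 B + superset_sum d2 B.
Proof. exact: big_split. Qed.

Lemma superset_sumN d B : superset_sum (fun A => - d A) B = - superset_sum d B.
Proof. exact: sumrN. Qed.

(** The system is triangular: apart from [d B], a superset sum involves only proper supersets of
    [B], so induction on the size of the complement recovers every value. This makes differently
    shifted families disjoint. *)
Lemma superset_sum_inj (BB : {set {set T}}) d1 d2 :
  (forall A, A \notin BB -> d1 A = d2 A) ->
  {in BB, superset_sum d1 =1 superset_sum d2} -> d1 =1 d2.
Proof.
move=> d12 sE B; have [k] := ubnP #|~: B|; elim: k B => // k IHk B Bk.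
have [BBB|/d12 //] := boolP (B \in BB).
have := sE B BBB; rewrite /superset_sum !(bigD1 B (P := fun A => B \subset A)) //=.
rewrite [X in d2 B + X](eq_bigr d1) => [/addIr //|A /andP[sBA nAB]]; apply/esym/IHk.
rewrite (leq_trans _ (_ : #|~: B| <= k)%N) // proper_card // properC.
by rewrite properEneq eq_sym nAB.
Qed.

(* The value at [set0] makes the total zero and affects no superset sum of a nonempty set. *)
Definition balanced_shift (t : {ffun {set T} -> nat}) A : int :=
  if A == finset.set0 then - \sum_B (t B)%:Z else (t A)%:Z.

Lemma superset_sum_balanced (t : {ffun {set T} -> nat}) B : B != finset.set0 ->
  superset_sum (balanced_shift t) B = superset_sum (fun A => (t A)%:Z) B.
Proof.
move=> B0; apply: eq_bigr => A sBA; rewrite /balanced_shift.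
by have [A0|//] := eqVneq A finset.set0; move: sBA B0; rewrite A0 subset0 => ->.
Qed.

Lemma sum_balanced_shift (t : {ffun {set T} -> nat}) : t finset.set0 = 0%N ->
  \sum_A balanced_shift t A = 0.
Proof.
move=> t0; rewrite (bigD1 finset.set0) //= {1}/balanced_shift eqxx.
rewrite (bigD1 finset.set0) //= t0 add0r addrC; apply/eqP; rewrite subr_eq0; apply/eqP.
by apply: eq_bigr => A /negPf A0; rewrite /balanced_shift A0.
Qed.

Lemma normr_balanced_shift (BB : {set {set T}}) (t : {ffun {set T} -> nat}) (s : nat) A :
  (forall B, t B <= s)%N -> (forall B, B \notin BB -> t B = 0%N) ->
  `|balanced_shift t A| <= (#|BB|.+1 * s)%:Z.
Proof.
move=> ts tB; rewrite /balanced_shift; case: ifP => _; last first.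
  by rewrite ger0_norm // lez_nat (leq_trans (ts A)) // mulSn leq_addr.
rewrite normrN -(big_morph Posz PoszD (erefl _)) ger0_norm // lez_nat.
rewrite (bigID (mem BB)) /= [X in (_ + X)%N]big1 ?addn0 => [|B /tB //].
apply: (@leq_trans (\sum_(B in BB) s)); first exact: leq_sum.
by rewrite sum_nat_const leq_mul2r leqnSn orbT.
Qed.

End SupersetSums.

(** * Symmetric shifts and packing of the shifted families *)

Section UpperBound.
Variables (R : realType) (T : finType) (BB : {set {set T}}).
Hypothesis BB0 : finset.set0 \notin BB.

Local Notation ty := (@colour_count {set T} _).
Local Notation K := (#|{set T}|).

(* Log-concavity of the multinomial coefficients. *)
Lemma class_le_symmetric_shift n (c : {ffun 'I_n -> {set T}}) (d : {set T} -> int) (L M : R) :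
  0 < L -> \sum_A d A = 0 ->
  (forall A, (`|d A|)%:~R <= M) -> (forall A, L + M <= (ty c A)%:~R) ->
  #|colour_class n (ty c)|%:R <= expR (K%:R * (2 * M ^+ 2 / L)) *
     (#|colour_class n (fun A => ty c A + d A)|%:R + #|colour_class n (fun A => ty c A - d A)|%:R).
Proof.
move=> L0 sd dM tyL.
have [K0|/card_gt0P [A0 _]] := posnP K.
  by move/card0_eq: K0 => /(_ finset.set0).
have M0 : 0 <= M by apply: le_trans (dM A0); rewrite ler0z.
have dd A : - M <= (d A)%:~R <= M by rewrite -ler_norml -intr_norm.
have ge0 A : 0 <= ty c A := colour_count_ge0 c A.
have pL A : L <= (ty c A + d A)%:~R by rewrite intrD; have := tyL A; have /andP[] := dd A; lra.
have mL A : L <= (ty c A - d A)%:~R by rewrite intrB; have := tyL A; have /andP[] := dd A; lra.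
have p0 A : 0 < ty c A + d A by rewrite -(ltr0z R) (lt_le_trans L0).
have m0 A : 0 < ty c A - d A by rewrite -(ltr0z R) (lt_le_trans L0).
have := colour_class_ratio R ge0 (sum_colour_count c) p0.
rewrite big_split /= sd addr0 sum_colour_count => /(_ erefl).
have := colour_class_ratio R ge0 (sum_colour_count c) m0.
rewrite sumrB /= sd subr0 sum_colour_count => /(_ erefl).
set fp := (#|colour_class n (fun A => ty c A + d A)|%:R : R).
set fm := (#|colour_class n (fun A => ty c A - d A)|%:R : R).
move=> hm hp.
set E := expR _.
have E1 : 1 <= E by rewrite -[leLHS]expR0 ler_expR !mulr_ge0 ?exprn_ge0 ?invr_ge0 ?(ltW L0).
(* Multiplying the two ratio bounds pairs the exponents into d(ln(x + d) - ln(x - d)), at most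
   2M^2/L for each colour. *)
have fpm : #|colour_class n (ty c)|%:R ^+ 2 <= fp * fm * E.
  apply: le_trans (ler_pM _ _ hp hm) _; rewrite ?ler0n //.
  rewrite mulrACA -expRD; apply: ler_wpM2l; first by rewrite mulr_ge0.
  rewrite ler_expR -big_split /=; apply: (@le_trans _ _ (\sum_(A : {set T}) (2 * M ^+ 2 / L))); last first.
    by rewrite sumr_const -[leLHS]mulr_natl.
  apply: ler_sum => A _.
  have -> : ty c A + d A - ty c A = d A by rewrite addrC addKr.
  have -> : ty c A - d A - ty c A = - d A by rewrite addrC addKr.
  rewrite rmorphN /= mulNr -mulrBr; apply: le_trans (mul_ln_sub_le _ L0 (pL A) (mL A)) _.
  apply: ler_wpM2r; first by rewrite invr_ge0 ltW.
  have nM : `|(d A)%:~R| <= M by rewrite ler_norml.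
  have -> : (ty c A + d A)%:~R - (ty c A - d A)%:~R = (d A)%:~R *+ 2 :> R.
    by rewrite intrD intrB; ring.
  have u0 := normr_ge0 ((d A)%:~R : R).
  by rewrite normrMn mulr2n; nra.
(* Squares are compared, using [fp * fm <= (fp + fm) ^+ 2] and [1 <= E]. *)
rewrite -(@ler_pXn2r _ 2) ?nnegrE ?mulr_ge0 ?addr_ge0 ?expR_ge0 ?ler0n //.
apply: le_trans fpm _.
have fp0 : 0 <= fp := ler0n _ _. have fm0 : 0 <= fm := ler0n _ _.
have : fp * fm <= (fp + fm) ^+ 2 by nra.
move=> h; rewrite exprMn [leLHS]mulrC expr2 -mulrA ler_wpM2l ?expR_ge0 //.
by apply: le_trans h _; rewrite ler_peMl // exprn_ge0 // addr_ge0.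
Qed.

(** The colourings in which every colour is frequent are shifted by each of (s + 1)^#|BB| vectors
    and by their negatives. For each sign the targets are disjoint, so the total is at most 2 K^n;
    the other colourings fall under the Chernoff bound. *)
Lemma card_superset_counts_le : exists C : R, 0 < C /\ exists n0 : nat,
  forall (n s : nat) (tau : {set T} -> int), (n0 <= n)%N -> (s ^ 2 <= n)%N ->
  (#|[set c : {ffun 'I_n -> {set T}} | [forall B in BB, superset_sum (ty c) B == tau B]]|)%:R
     * s%:R ^+ #|BB| <= C * K%:R ^+ n.
Proof.
have K0 : (0 < K)%N by apply/card_gt0P; exists finset.set0.
have KR0 : 0 < K%:R :> R by rewrite ltr0n.
have [C2 [C20 rare]] := rare_colour_negligible R {set T} #|BB|.
(* Balanced shifts have entries at most M = b s, and [n0] ensures M <= L = n/8K. A frequent colour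
   occurs at least n/4K = 2L times, hence at least L + M times; the exponent 2M^2/L is at most 16 K
   b^2, which gives [E]. *)
pose b := #|BB|.+1; pose n0 := (64 * K ^ 2 * b ^ 2)%N.
pose E : R := expR (K%:R * (16 * K%:R * b%:R ^+ 2)).
exists (2 * E + K%:R * C2); split.
  by rewrite addr_gt0 ?mulr_gt0 ?expR_gt0.
exists n0 => n s tau n0n sn.
have n_gt0 : (0 < n)%N by apply: leq_trans n0n; rewrite !muln_gt0 K0.
have nR0 : 0 < n%:R :> R by rewrite ltr0n.
set X := [set c | _]; pose a := (n %/ (4 * K))%N.
pose P := [set c in X | [forall A, a%:Z < ty c A]].
pose bad A := [set c : {ffun 'I_n -> {set T}} | ty c A <= a%:Z].
have XP : (#|X| <= #|P| + \sum_A #|bad A|)%N.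
  apply: card_le_sum_exceptions => c cX; have [cP|] := boolP [forall A, a%:Z < ty c A].
    by left; rewrite inE cX.
  by case/forallPn => A; rewrite -leNgt => cA; right; exists A; rewrite inE.
have badX A : (#|bad A|)%:R * s%:R ^+ #|BB| <= C2 * K%:R ^+ n.
  by apply: rare => //; rewrite mulnC leq_trunc_div.
suff PX : (#|P|)%:R * s%:R ^+ #|BB| <= 2 * E * K%:R ^+ n.
  apply: (@le_trans _ _ ((#|P| + \sum_A #|bad A|)%:R * s%:R ^+ #|BB|)).
    by rewrite ler_wpM2r ?exprn_ge0 // ler_nat.
  rewrite natrD mulrDl [leRHS]mulrDl lerD // natr_sum mulr_suml.
  apply: (@le_trans _ _ (\sum_(A : {set T}) (C2 * K%:R ^+ n))); first exact: ler_sum.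
  by rewrite sumr_const -mulrA -[leLHS]mulr_natl.
pose D : {pred {ffun {set T} -> 'I_s.+1}} := pffun_on ord0 (mem BB) predT.
pose tn (t : {ffun {set T} -> 'I_s.+1}) := [ffun B => (t B : nat)].
(* [false] stands for the shift by [t] and [true] for its negative. *)
pose Q (sg : bool) t := [set c : {ffun 'I_n -> {set T}} | [forall B in BB, superset_sum (ty c) B ==
  tau B + (-1) ^+ sg * superset_sum (fun A => (tn t A)%:Z) B]].
have tn_out t B : t \in D -> B \notin BB -> tn t B = 0%N.
  move=> /pffun_onP[/fintype.subsetP sub _] BB'; rewrite ffunE; apply/eqP; apply: contraR BB' => tB.
  by apply: sub; rewrite inE; apply: contra tB => /eqP ->.
have Qdisj sg : (\sum_(t in D) #|Q sg t| <= K ^ n)%N.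
  have -> : (K ^ n = #|{ffun 'I_n -> {set T}}|)%N by rewrite card_ffun card_ord.
  apply: sum_card_disjoint => t t' c tD t'D; rewrite !inE => /forallP h /forallP h'.
  suff: (fun A => (tn t A)%:Z) =1 (fun A => (tn t' A)%:Z).
    by move=> e; apply/ffunP => A; apply/val_inj; have := e A; rewrite !ffunE => -[].
  apply: (@superset_sum_inj _ BB) => [A AB|B BBB]; first by rewrite !tn_out.
  have := h B; have := h' B; rewrite BBB /= => /eqP -> /eqP /addrI.
  by case: (sg) => /=; rewrite ?expr1 ?mulN1r ?expr0 ?mul1r; [move/oppr_inj => -> | move=> ->].
have Pt t : t \in D -> (#|P|)%:R <= E * (#|Q false t|%:R + #|Q true t|%:R).
  move=> tD; pose d := balanced_shift (tn t).
  have tn0 : tn t finset.set0 = 0%N by rewrite tn_out.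
  pose M : R := (b * s)%:R; pose L : R := n%:R / (8 * K%:R).
  have L0 : 0 < L by rewrite divr_gt0 ?mulr_gt0.
  have Mn : (8 * K * (b * s) <= n)%N.
    rewrite -(@leq_exp2r _ _ 2) //; apply: (@leq_trans (n * n)); last by rewrite mulnn.
    apply: (@leq_trans (n0 * s ^ 2)); last by rewrite leq_mul.
    by rewrite /n0 !expnMn !mulnA.
  have dM A : (`|d A|)%:~R <= M :> R.
    rewrite -[M]/((b * s)%:Z%:~R) ler_int; apply: normr_balanced_shift => [B|B].
      by rewrite ffunE -ltnS.
    exact: tn_out.
  apply: (@card_le_shift R _ _ P (Q false t) (Q true t) d (fun A => - d A)); first exact: expR_ge0.
  - move=> c; rewrite inE => /andP[_ /forallP ca].
    apply: (@le_trans _ _ (expR (K%:R * (2 * M ^+ 2 / L)) *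
     (#|colour_class n (fun A => ty c A + d A)|%:R + #|colour_class n (fun A => ty c A - d A)|%:R))).
      apply: class_le_symmetric_shift => // [|A]; first exact: sum_balanced_shift.
      have ML : M <= L.
        by rewrite /L ler_pdivlMr ?mulr_gt0 // mulrC -!natrM ler_nat.
      apply: (@le_trans _ _ (n%:R / (4 * K%:R))).
        have -> : n%:R / (4 * K%:R) = L + L :> R by rewrite /L; field; rewrite pnatr_eq0 -lt0n.
        by rewrite lerD2l.
      apply: (@le_trans _ _ (a.+1%:Z%:~R)); last by rewrite ler_int; have := ca A; lia.
      rewrite ler_pdivrMr ?mulr_gt0 // -!natrM ler_nat mulnC ltnW // /a.
      by rewrite mulnC ltn_ceil // muln_gt0.
    apply: ler_wpM2r; first by rewrite addr_ge0.
    rewrite ler_expR ler_wpM2l // /L /M natrM exprMn invf_div.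
    have : s%:R ^+ 2 / n%:R <= 1 :> R by rewrite ler_pdivrMr // mul1r -natrX ler_nat.
    move=> h; have -> : 2 * (b%:R ^+ 2 * s%:R ^+ 2) * (8 * K%:R / n%:R) =
       16 * K%:R * b%:R ^+ 2 * (s%:R ^+ 2 / n%:R) :> R by field; rewrite gt_eqF.
    by rewrite ler_piMr // !mulr_ge0 ?exprn_ge0.
  - move=> c c'; rewrite inE => /andP[cX _] e; rewrite inE; apply/forall_inP => B BBB.
    have B0 : B != finset.set0 by apply: contraNneq BB0 => <-.
    move: cX; rewrite inE => /forall_inP /(_ B BBB) /eqP <-.
    rewrite expr0 mul1r -(superset_sum_balanced _ B0) -superset_sumD.
    by apply/eqP; apply: eq_bigr => A _; apply: e.
  - move=> c c'; rewrite inE => /andP[cX _] e; rewrite inE; apply/forall_inP => B BBB.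
    have B0 : B != finset.set0 by apply: contraNneq BB0 => <-.
    move: cX; rewrite inE => /forall_inP /(_ B BBB) /eqP <-.
    rewrite expr1 mulN1r -(superset_sum_balanced _ B0) -superset_sumN -superset_sumD.
    by apply/eqP; apply: eq_bigr => A _; apply: e.
have cD : #|D| = (s.+1 ^ #|BB|)%N.
  by rewrite card_pffun_on card_ord.
apply: (@le_trans _ _ (\sum_(t in D) (#|P|)%:R)).
  rewrite sumr_const cD -[leRHS]mulr_natr ler_wpM2l // -natrX ler_nat.
  by case: (#|BB|) => // ?; rewrite leq_exp2r // leqnSn.
apply: (@le_trans _ _ (\sum_(t in D) E * (#|Q false t|%:R + #|Q true t|%:R))).
  exact: ler_sum.
rewrite -mulr_sumr big_split /= -!natr_sum [2 * E]mulrC -mulrA ler_wpM2l ?expR_ge0 //.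
by rewrite mulrDl mul1r -natrX lerD // ler_nat Qdisj.
Qed.

End UpperBound.

(** * Lower bound for the number of balanced colourings *)

Section Variance.
Variables (R : realType) (Omega : finType).

(** The variance of a sum of [n] independent centred variables, with [#|Omega|] cleared from the
    denominator. In the induction the cross term vanishes because [xi] sums to 0. *)
Lemma sum_sqr_centered n (xi : Omega -> R) : \sum_w xi w = 0 ->
  #|Omega|%:R * \sum_(c : {ffun 'I_n -> Omega}) (\sum_i xi (c i)) ^+ 2
    = n%:R * #|Omega|%:R ^+ n * \sum_w xi w ^+ 2.
Proof.
move=> xi0; elim: n => [|n IHn].
  by rewrite big1 ?mulr0 ?mul0r // => c _; rewrite big_ord0 expr0n.
rewrite sum_colour_cons exchange_big /=.
rewrite (eq_bigr (fun c : {ffun 'I_n -> Omega} =>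
   \sum_w xi w ^+ 2 + #|Omega|%:R * (\sum_i xi (c i)) ^+ 2)); last first.
  move=> c _; rewrite (eq_bigr (fun A => xi A ^+ 2 + (xi A * (2 * \sum_i xi (c i)) + (\sum_i xi (c i)) ^+ 2))).
    by rewrite !big_split /= -mulr_suml xi0 mul0r add0r sumr_const mulr_natl.
  by move=> A _; rewrite (@big_colour_cons _ _ _ xi); ring.
rewrite big_split /= -mulr_sumr IHn sumr_const card_ffun card_ord -[X in _ * (X + _)]mulr_natl natrX.
by rewrite exprS -natr1; ring.
Qed.

(** Chebyshev's inequality for the centred variable K [w = A] - 1. The factor 4K on the left makes
    the union over all K colours cost at most a quarter of the colourings. *)
Lemma card_atypical_colour n s A : (n <= 4 * s ^ 2)%N -> (0 < s)%N ->
  4 * #|Omega|%:R * (#|[set c : {ffun 'I_n -> Omega} |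
     (4 * #|Omega| * s)%:Z < `|#|Omega|%:Z * colour_count c A - n%:Z| ]|)%:R
    <= #|Omega|%:R ^+ n :> R.
Proof.
move=> ns s0; set K := #|Omega|; set bad := [set c | _].
have K0 : (0 < K)%N by apply/card_gt0P; exists A.
have KR : 0 < K%:R :> R by rewrite ltr0n.
pose xi w : R := K%:R * (w == A)%:R - 1.
have xi0 : \sum_w xi w = 0.
  rewrite sumrB sumr_const -mulr_sumr (bigD1 A) //= eqxx big1 => [|w /negPf -> //].
  by rewrite addr0 mulr1 subrr.
have xi2 : \sum_w xi w ^+ 2 <= K%:R ^+ 2.
  rewrite (eq_bigr (fun w => K%:R * (K%:R - 2) * (w == A)%:R + 1)) => [|w _]; last first.
    by rewrite /xi; case: eqP => _ /=; ring.
  rewrite big_split /= sumr_const -mulr_sumr (bigD1 A) //= eqxx big1 => [|w /negPf -> //].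
  by rewrite -[#|xpredT|]/K addr0 mulr1; nra.
have SE (c : {ffun 'I_n -> Omega}) : \sum_i xi (c i) = (K%:Z * colour_count c A - n%:Z)%:~R.
  rewrite /xi sumrB sumr_const card_ord -mulr_sumr intrB intrM; congr (_ * _ - _).
  by rewrite /colour_count rmorph_sum; apply: eq_bigr => i _; case: eqP.
have := sum_sqr_centered n xi0; rewrite -/K => V.
have Vle : \sum_(c : {ffun 'I_n -> Omega}) (\sum_i xi (c i)) ^+ 2 <= 4 * s%:R ^+ 2 * K%:R * K%:R ^+ n.
  rewrite -(ler_pM2l KR) V; apply: (@le_trans _ _ ((4 * s%:R ^+ 2) * K%:R ^+ n * K%:R ^+ 2)).
    apply: ler_pM; rewrite ?mulr_ge0 ?exprn_ge0 //.
      by apply: sumr_ge0 => w _; rewrite sqr_ge0.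
    by apply: ler_wpM2r; rewrite ?exprn_ge0 // -natrX -natrM ler_nat.
  by rewrite le_eqVlt; apply/orP; left; apply/eqP; ring.
have badle : #|bad|%:R * (4 * K%:R * s%:R) ^+ 2 <= \sum_(c : {ffun 'I_n -> Omega}) (\sum_i xi (c i)) ^+ 2.
  rewrite mulr_natl -sumr_const big_mkcond /=; apply: ler_sum => c _.
  case: ifP; last by rewrite sqr_ge0.
  rewrite inE SE => cb; rewrite -[leRHS]real_normK ?num_real // lerXn2r ?nnegrE ?mulr_ge0 //.
  by rewrite -intr_norm -!natrM -[leLHS]/((4 * K * s)%:Z%:~R) ler_int ltW.
have s2 : 0 < s%:R ^+ 2 * (4 * K%:R) :> R by rewrite !mulr_gt0 ?exprn_gt0 ?ltr0n.
have := le_trans badle Vle.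
have -> : #|bad|%:R * (4 * K%:R * s%:R) ^+ 2 = s%:R ^+ 2 * (4 * K%:R) * (4 * K%:R * #|bad|%:R) :> R by ring.
have -> : 4 * s%:R ^+ 2 * K%:R * K%:R ^+ n = s%:R ^+ 2 * (4 * K%:R) * K%:R ^+ n :> R by ring.
by rewrite ler_pM2l.
Qed.

End Variance.

(** * An explicit type with exact superset counts *)

Section BaseType.
Variable T : finType.
Implicit Types (B : {set T}) (g w : {set T} -> int).

(** The triangular system is solved over the integers from the top, by decreasing size of the
    set. *)
Lemma superset_sum_surj g : exists w, superset_sum w =1 g.
Proof.
suff [w wg] : exists w, forall B, (#|~: B| < #|T|.+1)%N -> superset_sum w B = g B.
  by exists w => B; rewrite wg // ltnS max_card.
elim: #|T|.+1 => [|k [w wg]]; first by exists (fun=> 0).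
have below (A B : {set T}) : B \proper A -> (#|~: B| < k.+1)%N -> (#|~: A| < k)%N.
  by move=> BA; rewrite ltnS; apply: leq_trans; rewrite proper_card // properC.
exists (fun A => if (#|~: A| < k)%N then w A else g A - \sum_(A' : {set T} | A \proper A') w A').
have eqD w' B : superset_sum w' B = w' B + \sum_(A : {set T} | B \proper A) w' A.
  rewrite /superset_sum (bigD1 B) //=; congr (_ + _); apply: eq_bigl => A.
  by rewrite properEneq andbC eq_sym.
move=> B Bk; rewrite eqD [X in _ + X](eq_bigr w) => [|A BA]; last by rewrite (below _ _ BA Bk).
case: ifP => [Bk'|_]; last by rewrite subrK.
by rewrite -eqD wg.
Qed.

Lemma card_supersets B : (#|[set A : {set T} | B \subset A]| * 2 ^ #|B| = #|{set T}|)%N.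
Proof.
have -> : #|{set T}| = (2 ^ #|T|)%N by rewrite -[LHS]cardsT -powersetT card_powerset cardsT.
have -> : #|[set A : {set T} | B \subset A]| = (2 ^ #|~: B|)%N.
  rewrite -card_powerset -(on_card_preimset (f := fun A : {set T} => ~: A)); last first.
    by apply: onW_bij; exists (fun A => ~: A) => A; rewrite setCK.
  by apply: eq_card => A; rewrite !inE subsetC.
by rewrite -expnD addnC cardsC.
Qed.

(** Write k = tK + q with q < K. The constant 4t has superset sums 4tK / 2^|B|, and [q] copies of an
    integer solution [w] with sums 4 / 2^|B| supply the rest. Since q < K, the deviation from
    uniformity is bounded independently of [k]. *)
Lemma exists_balanced_type : exists W : nat, forall k : nat, exists m : {set T} -> int,
  (forall B, (#|B| <= 2)%N -> superset_sum m B * (2 ^ #|B|)%:Z = (4 * k)%:Z) /\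
  (forall A, `|#|{set T}|%:Z * m A - (4 * k)%:Z| <= W%:Z).
Proof.
set K := #|{set T}|.
have K0 : (0 < K)%N by apply/card_gt0P; exists finset.set0.
have [w wg] := superset_sum_surj (fun B => (2 ^ (2 - #|B|))%:Z).
pose W0 := (\sum_A absz (w A))%N.
have wW A : `|w A| <= W0%:Z by rewrite -abszE lez_nat /W0 (bigD1 A) //= leq_addr.
exists (K * (K * W0 + 4))%N => k; pose t := (k %/ K)%N; pose q := (k %% K)%N.
have kE : k = (t * K + q)%N by apply: divn_eq.
have qK : (q < K)%N by rewrite ltn_mod.
exists (fun A => 4 * t%:Z + q%:Z * w A); split => [B B2|A].
  rewrite superset_sumD.
  have -> : superset_sum (fun A => q%:Z * w A) B = q%:Z * superset_sum w B.
    by rewrite /superset_sum mulr_sumr.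
  rewrite wg /superset_sum sumr_const.
  have -> : #|[pred A : {set T} | B \subset A]| = #|[set A : {set T} | B \subset A]|.
    by apply: eq_card => A; rewrite !inE.
  have cs : (#|[set A : {set T} | B \subset A]|)%:Z * (2 ^ #|B|)%:Z = K%:Z.
    by rewrite -PoszM card_supersets.
  have e2 : (2 ^ (2 - #|B|))%:Z * (2 ^ #|B|)%:Z = 4 by rewrite -PoszM -expnD subnK.
  rewrite -[_ *+ #|_|]mulr_natr (natz #|[set A : {set T} | B \subset A]|) mulrDl -!mulrA cs e2 kE; lia.
have -> : K%:Z * (4 * t%:Z + q%:Z * w A) - (4 * k)%:Z = q%:Z * (K%:Z * w A - 4) by rewrite kE; lia.
rewrite normrM PoszM; apply: ler_pM => //; first by rewrite ger0_norm // lez_nat ltnW.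
apply: le_trans (ler_normB _ _) _; rewrite normrM PoszD PoszM lerD // ger0_norm //.
by apply: ler_wpM2l.
Qed.

End BaseType.

(** * Moving fibres of typical colourings onto the balanced counts *)

Section LowerBound.
Variables (R : realType) (T : finType) (BB : {set {set T}}).
Hypothesis BB2 : forall B, B \in BB -> (#|B| <= 2)%N.

Local Notation ty := (@colour_count {set T} _).
Local Notation K := (#|{set T}|).

(** The occurrence of every colour will make the encoded vertices pairwise distinct. *)
Definition balanced_colourings n := [set c : {ffun 'I_n -> {set T}} |
  [forall B in BB, superset_sum (ty c) B * (2 ^ #|B|)%:Z == n%:Z] && [forall A, 0 < ty c A]].

(** The typical colourings [G] split into at most (9 K^2 s)^b fibres with equal superset counts, and
    each fibre is moved by a single shift into the balanced colourings at the price of a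
    constant. *)
Lemma card_balanced_colourings_ge : exists C : R, 0 < C /\ exists n0 : nat,
  forall k s : nat, (n0 <= 4 * k)%N -> (s ^ 2 <= 4 * k)%N -> (4 * k <= 4 * s ^ 2)%N ->
  K%:R ^+ (4 * k) <= C * (#|balanced_colourings (4 * k)|)%:R * s%:R ^+ #|BB|.
Proof.
have K0 : (0 < K)%N by apply/card_gt0P; exists finset.set0.
have KR0 : 0 < K%:R :> R by rewrite ltr0n.
have [W base] := exists_balanced_type T; pose b := #|BB|.
(* Shift entries are at most 5s, shifted types lie within 9s of n/K, and L = n/2K bounds the entries
   from below: 5s * 9s / L <= 90 K per colour. *)
pose E : R := expR (K%:R * (90 * K%:R)).
exists (2 * (2 * E) * (9 * K ^ 2)%:R ^+ b); split.
  by rewrite !mulr_gt0 ?expR_gt0 ?exprn_gt0 // ltr0n muln_gt0 expn_gt0 K0.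
(* The three summands yield [W <= s], [18 * K * s <= n] and [0 < n]. *)
exists (4 * W ^ 2 + 18 ^ 2 * K ^ 2 + 1)%N => k s.
move: (base k) => [m [mB mW]] {base}; set n := (4 * k)%N in mB mW * => n0 sn ns.
clearbody n; have n_gt0 : (0 < n)%N by lia.
have nR0 : 0 < n%:R :> R by rewrite ltr0n.
have s_gt0 : (0 < s)%N by rewrite lt0n; apply: contraTN n_gt0 => /eqP s0; rewrite s0 in ns; lia.
have Ws : (W <= s)%N by rewrite -(@leq_exp2r _ _ 2) //; lia.
have sKn : (18 * K * s <= n)%N.
  rewrite -(@leq_exp2r _ _ 2) // !expnMn -[(n ^ 2)%N]mulnn leq_mul //; lia.
pose bad A := [set c : {ffun 'I_n -> {set T}} | (4 * K * s)%:Z < `|K%:Z * ty c A - n%:Z| ].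
pose G := [set c : {ffun 'I_n -> {set T}} | [forall A, `|K%:Z * ty c A - n%:Z| <= (4 * K * s)%:Z ]].
have GE : K%:R ^+ n <= 2 * #|G|%:R :> R.
  have : (#|[set: {ffun 'I_n -> {set T}}]| <= #|G| + \sum_A #|bad A|)%N.
    apply: card_le_sum_exceptions => c _; have [cG|] := boolP (c \in G); first by left.
    by rewrite inE => /forallPn[A]; rewrite -ltNge => h; right; exists A; rewrite inE.
  rewrite cardsT card_ffun card_ord -(ler_nat R) natrD natrX natr_sum => h.
  have {h} h : K%:R ^+ n <= #|G|%:R + \sum_(A : {set T}) #|bad A|%:R :> R by exact: h.
  have Kn0 : 0 <= K%:R ^+ n :> R by rewrite exprn_ge0.
  have : 4 * \sum_(A : {set T}) (#|bad A|)%:R <= K%:R ^+ n :> R.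
    rewrite -(ler_pM2l KR0) mulrCA !mulrA mulr_sumr.
    apply: (@le_trans _ _ (\sum_(A : {set T}) (K%:R ^+ n))); last by rewrite sumr_const -[leLHS]mulr_natl.
    by apply: ler_sum => A _; apply: card_atypical_colour.
  lra.
pose N := (8 * K ^ 2 * s)%N.
pose D : {pred {ffun {set T} -> 'I_N.+1}} := pffun_on ord0 (mem BB) predT.
(* At most K deviations of size 4 K s are summed, so the offset puts [code] between 0 and [N], where
   [inord] loses nothing. *)
pose code (c : {ffun 'I_n -> {set T}}) (B : {set T}) : int :=
  \sum_(A : {set T} | B \subset A) (K%:Z * ty c A - n%:Z) + (4 * K ^ 2 * s)%:Z.
have codeP c (B : {set T}) : c \in G -> 0 <= code c B <= N%:Z.
  rewrite inE => /forallP cG.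
  have : `|\sum_(A : {set T} | B \subset A) (K%:Z * ty c A - n%:Z)| <= (4 * K ^ 2 * s)%:Z.
    apply: le_trans (ler_norm_sum _ _ _) _.
    apply: (@le_trans _ _ (\sum_(A : {set T}) (4 * K * s)%:Z)).
      rewrite big_mkcond /=; apply: ler_sum => A _; case: ifP => // _; exact: cG.
    by rewrite sumr_const -mulr_natr natz -[#|_|]/K -PoszM lez_nat; lia.
  by rewrite ler_norml /code /N; lia.
pose phi c := [ffun B => if B \in BB then inord (absz (code c B)) else ord0] : {ffun {set T} -> 'I_N.+1}.
have phiE c c' (B : {set T}) : c \in G -> c' \in G -> phi c = phi c' -> B \in BB ->
    superset_sum (ty c) B = superset_sum (ty c') B.
  move=> cG c'G /ffunP /(_ B); rewrite !ffunE => + BBB; rewrite BBB => /(congr1 val) /=.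
  have /andP[h1 h2] := codeP _ B cG; have /andP[h1' h2'] := codeP _ B c'G.
  rewrite !inordK ?ltnS -?lez_nat ?gez0_abs // => ae.
  have : code c B = code c' B by rewrite -[LHS]gez0_abs // -[RHS]gez0_abs // ae.
  rewrite /code => /addIr; rewrite !sumrB -!mulr_sumr => /addIr /mulfI; apply.
  by rewrite eqz_nat -lt0n.
have fib sig : #|[set c in G | phi c == sig]|%:R <= 2 * E * (#|balanced_colourings n|)%:R.
  set F := [set c in G | _].
  have [->|[c0 c0F]] := set_0Vmem F; first by rewrite cards0 !mulr_ge0 ?expR_ge0.
  move: (c0F); rewrite inE => /andP[c0G /eqP c0sig].
  (* One shift serves the whole fibre: every [c] in it has the superset counts of [c0], so
     [ty c + d] has those of [m]. *)
  pose d A := m A - ty c0 A.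
  have Gb c A : c \in G -> `|K%:Z * ty c A - n%:Z| <= (4 * K * s)%:Z by rewrite inE => /forallP.
  have sm : \sum_A m A = n%:Z.
    rewrite -(mB finset.set0) ?cards0 // mulr1; apply: eq_bigl => A.
    by rewrite sub0set.
  have sd : \sum_A d A = 0 by rewrite sumrB sm sum_colour_count subrr.
  have WKs : W%:Z <= (K * s)%:Z by rewrite lez_nat; apply: leq_trans Ws _; rewrite leq_pmull.
  have dle A : `|K%:Z * d A| <= (5 * K * s)%:Z.
    have := mW A; have := Gb _ A c0G; rewrite !ler_norml /d.
    by move: WKs; rewrite -/K; lia.
  have nule c A : c \in G -> `|K%:Z * (ty c A + d A) - n%:Z| <= (9 * K * s)%:Z.
    by move=> cG; have := dle A; have := Gb _ A cG; rewrite !ler_norml; lia.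
  have nupos c A : c \in G -> 0 < ty c A + d A.
    move=> cG; have := nule _ A cG; rewrite ler_norml => /andP[h _].
    rewrite -(pmulr_rgt0 _ (_ : 0 < K%:Z)) //; lia.
  have -> : 2 * E * (#|balanced_colourings n|)%:R = E * ((#|balanced_colourings n|)%:R + (#|balanced_colourings n|)%:R) by ring.
  have FQ c c' : c \in F -> ty c' =1 (fun A => ty c A + d A) -> c' \in balanced_colourings n.
    rewrite inE => /andP[cG /eqP csig] e; rewrite inE; apply/andP; split; last first.
      by apply/forallP => A; rewrite e nupos.
    apply/forall_inP => B BBB; rewrite -(mB B) ?BB2 //; apply/eqP; congr (_ * _).
    have h : superset_sum (ty c) B = superset_sum (ty c0) B by apply: phiE => //; rewrite csig.
    transitivity (superset_sum (fun A => ty c A + d A) B); first by apply: eq_bigr => A _; apply: e.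
    by rewrite superset_sumD h /d superset_sumD superset_sumN addrC subrK.
  apply: (@card_le_shift R _ _ F _ _ d d) => //; first exact: expR_ge0.
  move=> c; rewrite inE => /andP[cG _].
  apply: (@le_trans _ _ (E * #|colour_class n (fun A => ty c A + d A)|%:R)); last first.
    by rewrite ler_wpM2l ?expR_ge0 // lerDl.
  apply: le_trans (colour_class_ratio R (fun A => colour_count_ge0 c A) (sum_colour_count c) (fun A => nupos c A cG) _) _.
    by rewrite big_split /= sd addr0 sum_colour_count.
  rewrite mulrC ler_wpM2r // ler_expR.
  (* Since [d] sums to 0, the constant ln(n/K) may be subtracted from each logarithm, which leaves
     terms of second order. *)
  rewrite (eq_bigr (fun A => (d A)%:~R * (ln (ty c A + d A)%:~R - ln (n%:R / K%:R)) + (d A)%:~R * ln (n%:R / K%:R))); last first.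
    by move=> A _; rewrite -mulrDr subrK [ty c A + d A]addrC addrK.
  rewrite big_split /= -mulr_suml -rmorph_sum sd mul0r addr0.
  pose L : R := n%:R / (2 * K%:R).
  have L0 : 0 < L by rewrite divr_gt0 ?mulr_gt0.
  apply: (@le_trans _ _ (\sum_(A : {set T}) (90 * K%:R : R))); last by rewrite sumr_const -[leLHS]mulr_natl.
  apply: ler_sum => A _.
  have dR : `|(d A)%:~R| <= 5 * s%:R :> R.
    rewrite -(ler_pM2l KR0) -[X in X * `|_|]ger0_norm // -normrM.
    have := dle A; rewrite -(ler_int R) intr_norm intrM => h.
    by apply: le_trans h _; rewrite -[leLHS]/((5 * K * s)%:R) !natrM mulrCA mulrA.
  have nR : `|(ty c A + d A)%:~R - n%:R / K%:R| <= 9 * s%:R :> R.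
    rewrite -(ler_pM2l KR0) -[X in X * `|_|]ger0_norm // -normrM mulrBr mulrCA divff ?gt_eqF // mulr1.
    have := nule _ A cG; rewrite -(ler_int R) intr_norm intrB intrM => h.
    by apply: le_trans h _; rewrite -[leLHS]/((9 * K * s)%:R) !natrM mulrCA mulrA.
  have nKL : n%:R / K%:R = L + L by rewrite /L; field; rewrite gt_eqF.
  have sL : 9 * s%:R <= L.
    by rewrite /L ler_pdivlMr ?mulr_gt0 // -!natrM ler_nat; lia.
  apply: le_trans (mul_ln_sub_le _ L0 _ _) _.
  - by move: nR; rewrite ler_norml nKL => /andP[]; lra.
  - by rewrite nKL; lra.
  rewrite ler_pdivrMr //; apply: (@le_trans _ _ ((5 * s%:R) * (9 * s%:R))).
    by apply: ler_pM.
  have -> : 90 * K%:R * L = 45 * n%:R by rewrite /L; field; rewrite gt_eqF.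
  have : s%:R ^+ 2 <= n%:R :> R by rewrite -natrX ler_nat.
  nra.
have GD : (#|G| = \sum_(sig in D) #|[set c in G | phi c == sig]|)%N.
  rewrite -sum1_card (partition_big phi D) /=; last first.
    move=> c _; apply/pffun_onP; split => //; apply/fintype.subsetP => B.
    by rewrite inE ffunE; case: ifP => //; rewrite eqxx.
  apply: eq_bigr => sig _; rewrite -sum1_card; apply: eq_bigl => c.
  by rewrite inE.
have cD : (#|D| <= (9 * K ^ 2 * s) ^ b)%N.
  rewrite card_pffun_on card_ord -/b; case: (b) => // b'; rewrite leq_exp2r // /N.
  have : (0 < K ^ 2 * s)%N by rewrite muln_gt0 expn_gt0 K0.
  by rewrite -!mulnA; lia.
apply: le_trans GE _; rewrite -!mulrA ler_wpM2l // GD natr_sum.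
apply: (@le_trans _ _ (\sum_(sig in D) 2 * E * (#|balanced_colourings n|)%:R)); first exact: ler_sum.
rewrite sumr_const -[leLHS]mulr_natr -!mulrA; do 2!rewrite ler_wpM2l ?expR_ge0 //.
rewrite mulrCA ler_wpM2l //; apply: le_trans (_ : ((9 * K ^ 2 * s) ^ b)%:R <= _); first by rewrite ler_nat.
by rewrite natrX natrM exprMn.
Qed.

End LowerBound.

(** * Embeddings into the distance graph *)

Section EdgesOfG.
Variable n : nat.
Implicit Types x y u v : cube n.

Lemma ipC x y : ip x y = ip y x.
Proof. by apply: eq_card => i; rewrite !inE andbC. Qed.

Lemma set2_eq (X : finType) (x y u v : X) : [set x; y] = [set u; v] ->
  (x = u /\ y = v) \/ (x = v /\ y = u).
Proof.
move=> e.
have /set2P[xu|xv] : x \in [set u; v] by rewrite -e !inE eqxx.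
  subst x; have /set2P[yu|yv] : y \in [set u; v] by rewrite -e !inE eqxx orbT.
    have : v \in [set u; y] by rewrite e !inE eqxx orbT.
    by rewrite yu setUid inE => /eqP ->; left.
  by left.
subst x; have /set2P[yu|yv] : y \in [set u; v] by rewrite -e !inE eqxx orbT.
  by right.
have : u \in [set v; y] by rewrite e !inE eqxx.
by rewrite yv setUid inE => /eqP ->; left.
Qed.

Lemma set2_Edg x y :
  ([set x; y] \in Edg n) = [&& x \in Vdg n, y \in Vdg n & ip x y == n %/ 4]%N.
Proof.
apply/idP/idP => [|/and3P[xV yV xy]]; rewrite inE.
  case/existsP => u /existsP[v /and4P[uV vV uv /eqP/set2_eq[[-> ->]|[-> ->]]]].
    by rewrite uV vV.
  by rewrite ipC uV vV.
by apply/existsP; exists x; apply/existsP; exists y; rewrite xV yV xy eqxx.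
Qed.

End EdgesOfG.

Definition edge_image (T X : finType) (f : T -> X) (E : {set {set T}}) : {set {set X}} :=
  [set f @: s | s : {set T} in E].

Definition embeddings (n : nat) (T : finType) (E : {set {set T}}) : {set {ffun T -> cube n}} :=
  [set f : {ffun T -> cube n} |
    [&& injectiveb f, [forall a, f a \in Vdg n] & edge_image f E \subset Edg n]].

Section Embeddings.
Variables (T : finType) (E : {set {set T}}).
Hypothesis E2 : forall s, s \in E -> #|s| = 2%N.

(** The sets with a prescribed superset count: a singleton encodes the weight n/2 of a vertex, an
    edge the inner product n/4, both equal to n / 2^|B|. *)
Definition vertices_edges : {set {set T}} := [set B : {set T} | #|B| == 1%N] :|: E.

Lemma card_vertices_edges : #|vertices_edges| = (#|T| + #|E|)%N.
Proof.
rewrite cardsU disjoint_setI0 ?cards0 ?subn0; first by rewrite card_draws bin1.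
rewrite disjoints_subset; apply/fintype.subsetP => B; rewrite !inE => B1.
by apply: contraTN B1 => /E2 ->.
Qed.

Variable n : nat.

Definition transpose_map (f : {ffun T -> cube n}) : {ffun 'I_n -> {set T}} :=
  [ffun i => [set a | f a i]].

Definition transpose_colouring (c : {ffun 'I_n -> {set T}}) : {ffun T -> cube n} :=
  [ffun a => [ffun i => a \in c i]].

Lemma transpose_mapK : cancel transpose_map transpose_colouring.
Proof. by move=> f; apply/ffunP => a; apply/ffunP => i; rewrite !ffunE inE. Qed.

Lemma transpose_colouringK : cancel transpose_colouring transpose_map.
Proof. by move=> c; apply/ffunP => i; apply/setP => a; rewrite !ffunE inE !ffunE. Qed.

Lemma superset_sum_colour_count (c : {ffun 'I_n -> {set T}}) B :
  superset_sum (colour_count c) B = (#|[set i | B \subset c i]|)%:Z.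
Proof.
rewrite /superset_sum exchange_big /= -sum1_card [X in _ = Posz X]big_mkcond /= (big_morph Posz PoszD (erefl _)).
apply: eq_bigr => i _; rewrite inE; case: ifP => Bc.
  by rewrite (bigD1 (c i)) //= eqxx big1 // => A /andP[_]; rewrite eq_sym => /negPf ->.
by rewrite big1 // => A BA; case: eqP => // cA; rewrite cA BA in Bc.
Qed.

Lemma supersets1_transpose (f : {ffun T -> cube n}) a :
  #|[set i | [set a] \subset transpose_map f i]| = #|[set i | f a i]|.
Proof. by apply: eq_card => i; rewrite !inE sub1set ffunE inE. Qed.

Lemma supersets2_transpose (f : {ffun T -> cube n}) a b :
  #|[set i | [set a; b] \subset transpose_map f i]| = ip (f a) (f b).
Proof. by apply: eq_card => i; rewrite !inE subUset !sub1set ffunE !inE. Qed.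

Lemma transpose_embedding f : f \in embeddings n E ->
  [forall B in vertices_edges,
     superset_sum (colour_count (transpose_map f)) B == (n %/ 2 ^ #|B|)%:Z].
Proof.
rewrite inE => /and3P[_ /forallP fV /fintype.subsetP fE]; apply/forall_inP => B.
rewrite !inE superset_sum_colour_count eqz_nat => /orP[/cards1P[a ->]|BE].
  by rewrite supersets1_transpose cards1; have := fV a; rewrite inE.
have B2 := E2 BE; move/eqP/cards2P: (B2) => [a [b [ab Bab]]].
rewrite B2 Bab supersets2_transpose.
have : f @: B \in Edg n by apply/fE/imset_f.
by rewrite Bab imsetU1 imset_set1 set2_Edg => /and3P[].
Qed.

Lemma transpose_balanced c :
  c \in balanced_colourings vertices_edges n -> transpose_colouring c \in embeddings n E.
Proof.
rewrite inE => /andP[/forall_inP cB /forallP c0].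
set f := transpose_colouring c; have cf : transpose_map f = c := transpose_colouringK c.
have fV a : f a \in Vdg n.
  have := cB [set a]; rewrite !inE cards1 eqxx => /(_ isT).
  by rewrite superset_sum_colour_count -cf supersets1_transpose; move: #|_| => N; rewrite -PoszM eqz_nat => /eqP <-; rewrite mulnK.
rewrite inE; apply/and3P; split; last first.
- apply/fintype.subsetP => _ /imsetP[B BE ->].
  have B2 := E2 BE; move/eqP/cards2P: (B2) => [a [b [ab Bab]]].
  rewrite Bab imsetU1 imset_set1 set2_Edg !fV /=.
  have := cB B; rewrite !inE B2 BE orbT => /(_ isT).
  by rewrite superset_sum_colour_count -cf Bab supersets2_transpose; move: (ip _ _) => N; rewrite -PoszM eqz_nat => /eqP <-; rewrite mulnK.
- exact/forallP.
- apply/injectiveP => a b fab.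
  (* At a coordinate coloured [[set b]], only the vertex of [b] has entry 1; equality of [f a] and
     [f b] there forces [a = b]. *)
  have := c0 [set b]; rewrite colour_countE ltz_nat card_gt0 => /set0Pn[i].
  rewrite inE => /eqP ci; have := congr1 (fun g : cube n => g i) fab.
  by rewrite /f !ffunE ci !inE eqxx => /eqP.
Qed.

End Embeddings.

Section EmbeddingCount.
Variables (R : realType) (T : finType) (E : {set {set T}}).
Hypothesis E2 : forall s, s \in E -> #|s| = 2%N.

Lemma card_set_type : #|{set T}| = (2 ^ #|T|)%N.
Proof. by rewrite -[LHS]cardsT -powersetT card_powerset cardsT. Qed.

Lemma card_embeddings_le : exists C : R, 0 < C /\ exists n0 : nat,
  forall n s : nat, (n0 <= n)%N -> (s ^ 2 <= n)%N ->
  (#|embeddings n E|)%:R * s%:R ^+ (#|T| + #|E|) <= C * (2 ^+ n) ^+ #|T|.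
Proof.
have VE0 : finset.set0 \notin vertices_edges E.
  by rewrite !inE cards0 /=; apply/negP => /E2; rewrite cards0.
have [C [C0 [n0 H]]] := card_superset_counts_le R VE0.
exists C; split => //; exists n0 => n s n0n sn.
have := H n s (fun B => (n %/ 2 ^ #|B|)%:Z) n0n sn.
rewrite card_vertices_edges // card_set_type natrX exprAC; apply: le_trans.
rewrite ler_wpM2r ?exprn_ge0 // ler_nat -(card_imset _ (can_inj (@transpose_mapK T n))).
apply/subset_leq_card/fintype.subsetP => _ /imsetP[f fE ->]; rewrite inE.
exact: transpose_embedding.
Qed.

Lemma card_embeddings_ge : exists C : R, 0 < C /\ exists n0 : nat,
  forall k s : nat, (n0 <= 4 * k)%N -> (s ^ 2 <= 4 * k)%N -> (4 * k <= 4 * s ^ 2)%N ->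
  (2 ^+ (4 * k)) ^+ #|T| <= C * (#|embeddings (4 * k) E|)%:R * s%:R ^+ (#|T| + #|E|).
Proof.
have VE2 B : B \in vertices_edges E -> (#|B| <= 2)%N.
  by rewrite !inE => /orP[/eqP ->|/E2 ->].
have [C [C0 [n0 H]]] := card_balanced_colourings_ge R VE2.
exists C; split => //; exists n0 => k s n0n sn ns.
have := H k s n0n sn ns.
rewrite card_vertices_edges // card_set_type natrX exprAC => h; apply: le_trans h _.
rewrite ler_wpM2r ?exprn_ge0 // ler_wpM2l ?(ltW C0) // ler_nat.
rewrite -(card_imset _ (can_inj (@transpose_colouringK T (4 * k)))).
apply/subset_leq_card/fintype.subsetP => _ /imsetP[c cB ->].
exact: transpose_balanced cB.
Qed.

End EmbeddingCount.

(** * Subgraphs as graphs on a vertex type of their own, to which the embedding counts apply *)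

Section Subpattern.
Variables (X : finType) (W : {set X}) (D : {set {set X}}).
Hypothesis DW : forall s, s \in D -> s \subset W.

Definition sub_vertex := {x : X | x \in W}.
Definition sub_edges : {set {set sub_vertex}} := [set s : {set sub_vertex} | val @: s \in D].

Lemma card_sub_vertex : #|{: sub_vertex}| = #|W|.
Proof. by rewrite card_sig; apply: eq_card. Qed.

Lemma val_imset_surj (s : {set X}) : s \subset W -> exists t : {set sub_vertex}, val @: t = s.
Proof.
move=> sW; exists [set u | val u \in s]; apply/setP => x; apply/imsetP/idP => [[u]|xs].
  by rewrite inE => us ->.
by exists (Sub x (fintype.subsetP sW x xs)); rewrite ?inE SubK.
Qed.

Lemma sub_edgesE : edge_image val sub_edges = D.
Proof.
apply/setP => s; apply/imsetP/idP => [[t]|sD]; first by rewrite inE => tD ->.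
by have [t ts] := val_imset_surj (DW sD); exists t; rewrite ?inE ts.
Qed.

Lemma card_sub_edges : #|sub_edges| = #|D|.
Proof. by rewrite -[in RHS]sub_edgesE card_imset //; apply/imset_inj/val_inj. Qed.

Lemma sub_edges2 : (forall s, s \in D -> #|s| = 2%N) -> forall s, s \in sub_edges -> #|s| = 2%N.
Proof. by move=> D2 s; rewrite inE => /D2; rewrite card_imset //; apply: val_inj. Qed.

Lemma edge_image_comp (Y : finType) (f : X -> Y) :
  edge_image (fun u : sub_vertex => f (val u)) sub_edges = edge_image f D.
Proof.
rewrite -[in RHS]sub_edgesE /edge_image -imset_comp; apply: eq_imset => s /=.
by rewrite -imset_comp.
Qed.

Lemma sub_embedding n (f : X -> cube n) : {in W &, injective f} ->
  (forall x, x \in W -> f x \in Vdg n) -> edge_image f D \subset Edg n ->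
  [ffun u : sub_vertex => f (val u)] \in embeddings n sub_edges.
Proof.
move=> finj fV fE; rewrite inE; apply/and3P; split.
- by apply/injectiveP => u v; rewrite !ffunE => /(finj _ _ (valP u) (valP v)) /val_inj.
- by apply/forallP => u; rewrite ffunE fV ?(valP u).
- rewrite (_ : edge_image _ _ = edge_image f D) // -edge_image_comp.
  by apply: eq_imset => s; apply: eq_imset => u; rewrite ffunE.
Qed.

End Subpattern.

(** * Moments in the random subgraph *)

Section RandomSubgraph.
Variables (R : realType) (n : nat) (p : R).
Hypothesis p01 : 0 <= p <= 1.
Implicit Types (S A : {set {set cube n}}) (P Q : {set {set cube n}} -> bool).

Let p0 : 0 <= p. Proof. by case/andP: p01. Qed.

Lemma wG_ge0 S : 0 <= wG p S.
Proof. by rewrite mulr_ge0 ?exprn_ge0 // subr_ge0; case/andP: p01. Qed.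

Lemma sum_wG : \sum_(S in powerset (Edg n)) wG p S = 1.
Proof. exact: sum_subset_weight. Qed.

Lemma sum_wG_superset A : A \subset Edg n ->
  \sum_(S in powerset (Edg n)) wG p S * (A \subset S)%:R = p ^+ #|A|.
Proof.
move=> AE; rewrite -(sum_superset_weight p AE) [RHS]big_mkcondr /=.
by apply: eq_bigr => S _; case: ifP; rewrite ?mulr1 ?mulr0.
Qed.

Lemma PrG_mono P Q : (forall S, S \subset Edg n -> P S -> Q S) -> PrG n p P <= PrG n p Q.
Proof.
move=> PQ; rewrite /PrG big_mkcondr [leRHS]big_mkcondr /=; apply: ler_sum => S.
by rewrite inE => SE; case: ifP => [/(PQ _ SE) ->|_] //; case: ifP; rewrite ?wG_ge0.
Qed.

Lemma PrG_compl P : PrG n p P + PrG n p (fun S => ~~ P S) = 1.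
Proof. by rewrite -sum_wG [RHS](bigID P). Qed.

Lemma PrG_ge0 P : 0 <= PrG n p P.
Proof. by apply: sumr_ge0 => S _; apply: wG_ge0. Qed.

Lemma PrG_le1 P : PrG n p P <= 1.
Proof. by rewrite -(PrG_compl P) lerDl PrG_ge0. Qed.

Lemma PrG_union_bound (I : finType) (F : {set I}) (A : I -> {set {set cube n}}) P :
  (forall i, i \in F -> A i \subset Edg n) ->
  (forall S, S \subset Edg n -> P S -> exists2 i, i \in F & A i \subset S) ->
  PrG n p P <= \sum_(i in F) p ^+ #|A i|.
Proof.
move=> AE PA; rewrite -(eq_bigr _ (fun i iF => sum_wG_superset (AE i iF))) exchange_big /=.
rewrite /PrG big_mkcondr /=; apply: ler_sum => S; rewrite inE => SE.
rewrite -mulr_sumr; case: ifP => [/(PA _ SE) [i iF iS]|_]; last first.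
  by rewrite mulr_ge0 ?wG_ge0 // sumr_ge0.
by rewrite ler_peMr ?wG_ge0 // (bigD1 i) //= iS lerDl sumr_ge0.
Qed.

Section SecondMoment.
Variables (I : finType) (C : {set I}) (A : I -> {set {set cube n}}) (e : nat).
Hypothesis AE : forall i, i \in C -> A i \subset Edg n.
Hypothesis cardA : forall i, i \in C -> #|A i| = e.
Variable X : {set {set cube n}} -> nat.
Hypothesis XE : forall S, S \subset Edg n -> X S = #|[set i in C | A i \subset S]|.

Lemma count_indicators S : S \subset Edg n -> (X S)%:R = \sum_(i in C) (A i \subset S)%:R :> R.
Proof.
move=> SE; rewrite XE // -sum1_card natr_sum [LHS]big_mkcond [RHS]big_mkcond /=.
by apply: eq_bigr => i _; rewrite inE; case: (i \in C) => //=; case: ifP.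
Qed.

Lemma EG_count : EG n p (fun S => (X S)%:R) = #|C|%:R * p ^+ e.
Proof.
transitivity (\sum_(S in powerset (Edg n)) \sum_(i in C) wG p S * (A i \subset S)%:R).
  by apply: eq_bigr => S; rewrite inE => SE; rewrite count_indicators // mulr_sumr.
rewrite exchange_big /= (eq_bigr (fun=> p ^+ e)) => [|i iC]; first by rewrite sumr_const mulr_natl.
by rewrite sum_wG_superset ?AE // cardA.
Qed.

Lemma EG_count_sqr :
  EG n p (fun S => (X S)%:R ^+ 2) = \sum_(i in C) \sum_(j in C) p ^+ #|A i :|: A j|.
Proof.
transitivity (\sum_(S in powerset (Edg n)) \sum_(i in C) \sum_(j in C) wG p S * (A i :|: A j \subset S)%:R).
  apply: eq_bigr => S; rewrite inE => SE; rewrite count_indicators // expr2 mulr_suml mulr_sumr.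
  apply: eq_bigr => i _; rewrite mulr_sumr mulr_sumr; apply: eq_bigr => j _.
  by rewrite subUset -mulnb natrM.
rewrite exchange_big /=; apply: eq_bigr => i iC; rewrite exchange_big /=; apply: eq_bigr => j jC.
by rewrite sum_wG_superset // subUset !AE.
Qed.

(** Chebyshev's inequality: edge-disjoint members of the family have zero covariance, so only pairs
    sharing an edge contribute to the variance bound. *)
Lemma PrG_concentration (eps : R) : 0 < eps -> 0 < p -> (0 < #|C|)%N ->
  1 - (\sum_(i in C) \sum_(j in C | ~~ [disjoint A i & A j]) p ^+ #|A i :|: A j|)
        / (eps ^+ 2 * (#|C|%:R * p ^+ e) ^+ 2)
  <= PrG n p (fun S => `|(X S)%:R / EG n p (fun S' => (X S')%:R) - 1| < eps).
Proof.
move=> eps0 pp C0; rewrite EG_count; set mu := #|C|%:R * p ^+ e.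
have mu0 : 0 < mu by rewrite mulr_gt0 ?exprn_gt0 // ltr0n.
set V := \sum_(i in C) _; set P := (fun S => _ < eps).
have em0 : 0 < eps ^+ 2 * mu ^+ 2 := mulr_gt0 (exprn_gt0 2 eps0) (exprn_gt0 2 mu0).
rewrite -(PrG_compl P) lerBlDr lerD2l ler_pdivlMr //.
have VE : EG n p (fun S => ((X S)%:R - mu) ^+ 2) <= V.
  have -> : EG n p (fun S => ((X S)%:R - mu) ^+ 2) =
     EG n p (fun S => (X S)%:R ^+ 2) - mu ^+ 2.
    rewrite /EG (eq_bigr (fun S => wG p S * (X S)%:R ^+ 2 +
       (wG p S * (X S)%:R * (- 2 * mu) + wG p S * mu ^+ 2))) => [|S _]; last by ring.
    rewrite !big_split /= -!mulr_suml sum_wG -[X in X * (-2 * mu)]/(EG n p (fun S => (X S)%:R)) EG_count -/mu.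
    by ring.
  (* Expanding the square over the same pairs makes the disjoint ones cancel term by term. *)
  have -> : mu ^+ 2 = \sum_(i in C) \sum_(j in C) p ^+ (e + e).
    rewrite (eq_bigr (fun=> #|C|%:R * p ^+ (e + e))) => [|i _]; last by rewrite sumr_const mulr_natl.
    by rewrite sumr_const -[RHS]mulr_natl exprD /mu; ring.
  rewrite EG_count_sqr -sumrB; apply: ler_sum => i iC.
  rewrite -sumrB big_mkcondr /=; apply: ler_sum => j jC.
  case: ifP => [_|/negbFE dij]; first by rewrite lerBlDr lerDl exprn_ge0.
  by rewrite cardsU disjoint_setI0 // cards0 subn0 !cardA // subrr.
apply: le_trans VE; clearbody mu; rewrite mulr_suml /EG big_mkcondr /=; apply: ler_sum => S _.
case: ifP => [|_]; last by rewrite mulr_ge0 ?wG_ge0 ?sqr_ge0.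
rewrite /P -leNgt => h; rewrite ler_wpM2l ?wG_ge0 //.
have -> : (X S)%:R - mu = ((X S)%:R / mu - 1) * mu by rewrite mulrBl divfK ?gt_eqF // mul1r.
rewrite [leRHS]exprMn ler_wpM2r ?sqr_ge0 // -[leRHS]real_normK ?num_real //.
by rewrite lerXn2r ?nnegrE ?(ltW eps0).
Qed.

End SecondMoment.
End RandomSubgraph.

(** * Copies of the pattern and their embeddings *)

Section Copies.
Variables (T : finType) (e : rel T).
Hypothesis e_irr : irreflexive e.
Let E := edgesF e.

Lemma edgesF2 s : s \in E -> #|s| = 2%N.
Proof.
rewrite inE => /existsP[a /existsP[b /andP[ab /eqP ->]]].
by rewrite cards2; case: eqP ab => // ->; rewrite e_irr.
Qed.

Lemma edge_image_pairs (X : finType) (f : T -> X) :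
  [set [set f ab.1; f ab.2] | ab in [set ab : T * T | e ab.1 ab.2]] = edge_image f E.
Proof.
apply/setP => s; apply/imsetP/imsetP => [[[a b]]|[t]].
  rewrite inE /= => ab ->; exists [set a; b]; last by rewrite imsetU1 imset_set1.
  by rewrite inE; apply/existsP; exists a; apply/existsP; exists b; rewrite ab eqxx.
rewrite inE => /existsP[a /existsP[b /andP[ab /eqP ->]]] ->.
by exists (a, b); rewrite ?inE // imsetU1 imset_set1.
Qed.

Definition copy_of n (f : T -> cube n) := (f @: [set: T], edge_image f E).

Lemma is_copyP n (S : {set {set cube n}}) H : S \subset Edg n ->
  reflect (exists f, [/\ f \in embeddings n E, H = copy_of f & H.2 \subset S]) (is_copy e S H).
Proof.
move=> SE; apply: (iffP and3P) => [[HV HS /existsP[f /and3P[finj /eqP H1 /eqP H2]]]|].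
  rewrite edge_image_pairs in H2.
  exists f; split => //; last by case: (H) H1 H2 => ? ? /= <- ->.
  rewrite inE finj -H2 (fintype.subset_trans HS SE) andbT /=.
  by apply/forallP => a; apply: (fintype.subsetP HV); rewrite -H1 imset_f.
move=> [f [fE HE HS]]; move: (fE); rewrite inE => /and3P[finj /forallP fV _].
split => //; first by rewrite HE; apply/fintype.subsetP => _ /imsetP[a _ ->].
by apply/existsP; exists f; rewrite finj edge_image_pairs HE /= !eqxx.
Qed.

Variable n : nat.

Definition copies : {set {set cube n} * {set {set cube n}}} := [set copy_of f | f : {ffun T -> cube n} in embeddings n E].

Lemma copiesP H : H \in copies -> H.2 \subset Edg n /\ #|H.2| = #|E|.
Proof.
case/imsetP => f; rewrite inE => /and3P[/injectiveP finj _ fE] -> /=; split => //.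
by rewrite card_imset //; apply: imset_inj.
Qed.

Lemma XF_copies (S : {set {set cube n}}) : S \subset Edg n ->
  XF e S = #|[set H in copies | H.2 \subset S]|.
Proof.
move=> SE; apply: eq_card => H; rewrite !inE.
apply/(is_copyP H SE)/andP => [[f [fE -> fS]]|[/imsetP[f fE ->] fS]].
  by split => //; apply: imset_f.
by exists f; split.
Qed.

Lemma contains_copyE (S : {set {set cube n}}) : contains_copy e S = (0 < XF e S)%N.
Proof.
apply/existsP/card_gt0P => [[H HS]|[H]]; first by exists H; rewrite inE.
by rewrite inE => HS; exists H.
Qed.

(** All embeddings with a given copy take values in its vertex set, which has [#|T|] elements; this
    bounds the automorphisms crudely by [#|T| ^ #|T|]. *)
Lemma card_copies_ge : (#|embeddings n E| <= #|T| ^ #|T| * #|copies|)%N.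
Proof.
rewrite -sum1_card (partition_big (fun f : {ffun T -> cube n} => copy_of f) (mem copies)) /=; last first.
  by move=> f fE; apply: imset_f.
rewrite mulnC -sum_nat_const; apply: leq_sum => H /imsetP[f0 f0E HE].
have cH : #|H.1| = #|T|.
  rewrite HE /= card_imset ?cardsT //; move: f0E; rewrite inE => /and3P[/injectiveP finj _ _].
  exact: finj.
rewrite sum1_card -{1}cH -card_ffun_on; apply/subset_leq_card/fintype.subsetP => f.
rewrite unfold_in => /andP[_ /eqP fH]; apply/ffun_onP => a.
by rewrite -fH /= imset_f.
Qed.

End Copies.

Lemma sum_imset_le (R : realType) (I J : finType) (A : {set I}) (h : I -> J) (G : J -> R) :
  (forall j, 0 <= G j) -> \sum_(j in h @: A) G j <= \sum_(i in A) G (h i).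
Proof.
move=> G0; rewrite [leRHS](partition_big h (mem (h @: A))) /=; last by move=> i iA; apply: imset_f.
apply: ler_sum => j /imsetP[i iA jE].
by rewrite (bigD1 i) ?iA ?jE //= lerDl; apply: sumr_ge0.
Qed.

Lemma imset_inj_in (X Y : finType) (W s t : {set X}) (f : X -> Y) :
  {in W &, injective f} -> s \subset W -> t \subset W -> f @: s = f @: t -> s = t.
Proof.
move=> finj /fintype.subsetP sW /fintype.subsetP tW st; apply/setP => x.
apply/idP/idP => xs.
  have : f x \in f @: t by rewrite -st imset_f.
  by case/imsetP=> y ys /finj -> //; [apply: sW | apply: tW].
have : f x \in f @: s by rewrite st imset_f.
by case/imsetP=> y ys /finj -> //; [apply: tW | apply: sW].
Qed.

(** * Unions of two copies that share an edge *)

Section Overlaps.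
Variables (T : finType) (E : {set {set T}}).
Hypothesis E2 : forall s, s \in E -> #|s| = 2%N.
Implicit Types g : {ffun T -> T + T}.

Definition overlap_vertices g : {set T + T} := inl @: [set: T] :|: g @: [set: T].

Definition overlap_edges g : {set {set T + T}} := edge_image inl E :|: edge_image g E.

(* [J] is the part of the first copy that is shared with the second one, whose
   vertices are placed by [g]. *)
Definition overlap_spec g (J : {set T} * {set {set T}}) : Prop :=
  [/\ J.2 \subset E, J.2 != finset.set0, forall s, s \in J.2 -> s \subset J.1,
      (#|overlap_vertices g| + #|J.1| = 2 * #|T|)%N
    & (#|overlap_edges g| + #|J.2| = 2 * #|E|)%N].

Lemma overlap_edges_sub g s : s \in overlap_edges g -> s \subset overlap_vertices g.
Proof.
by case/setUP=> /imsetP[t _ ->]; [apply: subsetU; rewrite imsetS // subsetT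
  | apply: subsetU; rewrite orbC imsetS // subsetT].
Qed.

Section Pair.
Variables (n : nat) (f f' : {ffun T -> cube n}).
Hypotheses (fE : f \in embeddings n E) (f'E : f' \in embeddings n E).

(* The union of the two copies is drawn on [T + T]: [inl] is the first copy, and the
   second copy is placed by [overlap], on the first one wherever they meet. *)
Definition overlap : {ffun T -> T + T} :=
  [ffun b => if [pick a | f a == f' b] is Some a then inl a else inr b].

(** Draws the abstract union back in the cube. It identifies [inl a] with [inr b] when [f a = f' b],
    but such an [inr b] is never a vertex of the union. *)
Definition glue (x : T + T) : cube n := match x with inl a => f a | inr b => f' b end.

Let finj : injective f. Proof. by move: fE; rewrite inE => /and3P[/injectiveP]. Qed.
Let f'inj : injective f'. Proof. by move: f'E; rewrite inE => /and3P[/injectiveP]. Qed.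

Lemma glue_overlap b : glue (overlap b) = f' b.
Proof. by rewrite ffunE; case: pickP => [a /eqP|]. Qed.

Lemma overlap_inj : injective overlap.
Proof. by move=> b b' /(congr1 glue); rewrite !glue_overlap => /f'inj. Qed.

Lemma glue_inj : {in overlap_vertices overlap &, injective glue}.
Proof.
have gW x : x \in overlap_vertices overlap ->
    (exists a, x = inl a) \/ (exists b, x = inr b /\ forall a, f a != f' b).
  case/setUP=> /imsetP[b _ ->]; first by left; exists b.
  rewrite ffunE; case: pickP => [a _|h]; first by left; exists a.
  by right; exists b; split => // a; rewrite h.
move=> x y /gW[[a ->]|[b [-> bf]]] /gW[[a' ->]|[b' [-> b'f]]] /=.
- by move/finj ->.
- by move=> e; have := b'f a; rewrite e eqxx.
- by move=> e; have := bf a'; rewrite e eqxx.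
- by move/f'inj ->.
Qed.

Lemma glue_vertices : glue @: overlap_vertices overlap = f @: [set: T] :|: f' @: [set: T].
Proof.
rewrite imsetU -!imset_comp; congr (_ :|: _).
by apply: eq_imset => b; rewrite /= glue_overlap.
Qed.

Lemma glue_edges : edge_image glue (overlap_edges overlap) = edge_image f E :|: edge_image f' E.
Proof.
rewrite /edge_image imsetU -!imset_comp; congr (_ :|: _); apply: eq_imset => s /=.
  by rewrite -imset_comp.
by rewrite -imset_comp; apply: eq_imset => b; rewrite /= glue_overlap.
Qed.

Lemma card_overlap_edges :
  #|overlap_edges overlap| = #|edge_image f E :|: edge_image f' E|.
Proof.
rewrite -glue_edges card_in_imset // => s t sD tD.
by apply: (imset_inj_in glue_inj); apply: overlap_edges_sub.
Qed.

Lemma overlap_edges2 s : s \in overlap_edges overlap -> #|s| = 2%N.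
Proof.
by case/setUP=> /imsetP[t /E2 <- ->]; rewrite card_imset //; [apply: inl_inj | apply: overlap_inj].
Qed.

(** Inclusion-exclusion for the vertex sets and the edge sets of the two copies, transported along
    [glue]. *)
Lemma overlapP : ~~ [disjoint edge_image f E & edge_image f' E] ->
  overlap_spec overlap ([set a | f a \in f' @: [set: T]], [set s in E | f @: s \in edge_image f' E]).
Proof.
have cE (h : {ffun T -> cube n}) : injective h -> #|edge_image h E| = #|E|.
  by move=> hinj; rewrite card_imset //; apply: imset_inj.
move=> nd; split => /=.
- by apply/fintype.subsetP => s; rewrite inE => /andP[].
- have [s] := pred0Pn nd; rewrite /= => /andP[/imsetP[t tE ->] tf'].
  by apply/set0Pn; exists t; rewrite inE tE.
- move=> s; rewrite inE => /andP[_ /imsetP[t _ st]]; apply/fintype.subsetP => a a_s.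
  have : f a \in f @: s by apply: imset_f.
  by rewrite st inE => /imsetP[b _ ->]; apply: imset_f.
- rewrite -(card_in_imset glue_inj) glue_vertices.
  have <- : #|f @: [set: T] :&: f' @: [set: T]| = #|[set a | f a \in f' @: [set: T]]|.
    rewrite -(card_imset _ finj); apply: eq_card => x; apply/setIP/imsetP.
      by case=> /imsetP[a _ ->] af'; exists a; rewrite ?inE.
    by case=> a; rewrite inE => af' ->; rewrite imset_f.
  by rewrite cardsUI !card_imset // cardsT addnn mul2n.
- rewrite card_overlap_edges.
  have <- : #|edge_image f E :&: edge_image f' E| = #|[set s in E | f @: s \in edge_image f' E]|.
    rewrite -(card_imset _ (imset_inj finj)); apply: eq_card => x; apply/setIP/imsetP.
      by case=> /imsetP[a aE ->] af'; exists a; rewrite ?inE ?aE.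
    by case=> a; rewrite inE => /andP[aE af'] ->; rewrite imset_f.
  by rewrite cardsUI !cE // addnn mul2n.
Qed.

Definition glued : {ffun sub_vertex (overlap_vertices overlap) -> cube n} :=
  [ffun u : sub_vertex (overlap_vertices overlap) => glue (val u)].

Lemma glued_embedding :
  glued \in embeddings n (sub_edges (overlap_vertices overlap) (overlap_edges overlap)).
Proof.
move: (fE); rewrite inE => /and3P[_ /forallP fV fG].
move: (f'E); rewrite inE => /and3P[_ /forallP f'V f'G].
apply: sub_embedding; first exact: overlap_edges_sub.
- exact: glue_inj.
- by move=> x /setUP[]/imsetP[a _ ->]; rewrite ?glue_overlap //=.
- by rewrite glue_edges subUset fG.
Qed.

End Pair.

(** For a fixed [g] the glued map determines the pair: [f] is its restriction along [inl], and [f']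
    its composite with [g]. *)
Lemma card_pairs_overlap_le n (A : {set {ffun T -> cube n} * {ffun T -> cube n}}) g :
  (forall q, q \in A -> [/\ q.1 \in embeddings n E, q.2 \in embeddings n E & overlap q.1 q.2 = g]) ->
  (#|A| <= #|embeddings n (sub_edges (overlap_vertices g) (overlap_edges g))|)%N.
Proof.
move=> Ag; pose h (q : {ffun T -> cube n} * {ffun T -> cube n}) : {ffun sub_vertex (overlap_vertices g) -> cube n} :=
  [ffun u : sub_vertex (overlap_vertices g) => glue q.1 q.2 (val u)].
have h_inj : {in A &, injective h}.
  move=> [f1 f1'] [f2 f2'] /Ag /= [_ _ g1] /Ag /= [_ _ g2] /ffunP e.
  have eW x : x \in overlap_vertices g -> glue f1 f1' x = glue f2 f2' x.
    by move=> xW; have := e (Sub x xW); rewrite /h !ffunE.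
  congr (_, _); apply/ffunP => a.
    by have := eW (inl a); apply; rewrite inE imset_f.
  have gaW : g a \in overlap_vertices g by rewrite in_setU orbC imset_f.
  have e1 : glue f1 f1' (g a) = f1' a by rewrite -g1 glue_overlap.
  have e2 : glue f2 f2' (g a) = f2' a by rewrite -g2 glue_overlap.
  by rewrite -e1 -e2 eW.
rewrite -(card_in_imset h_inj); apply/subset_leq_card/fintype.subsetP => _ /imsetP[q /Ag[q1 q2 gE] ->].
by have := glued_embedding q1 q2; rewrite /glued gE.
Qed.

(** Pairs are sorted by their overlap pattern, of which there are boundedly many. The edge-size
    condition is supplied by the patterns that occur; an arbitrary [g] might collapse an edge. *)
Lemma sum_overlapping_pairs_le (R : realType) n (p M : R) : 0 <= p -> 0 <= M ->
  (forall g J, overlap_spec g J -> (forall s, s \in overlap_edges g -> #|s| = 2%N) ->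
     (#|embeddings n (sub_edges (overlap_vertices g) (overlap_edges g))|)%:R * p ^+ #|overlap_edges g| <= M) ->
  \sum_(f in embeddings n E)
    \sum_(f' in embeddings n E | ~~ [disjoint edge_image f E & edge_image f' E])
       p ^+ #|edge_image f E :|: edge_image f' E| <= #|{ffun T -> T + T}|%:R * M.
Proof.
move=> p0 M0 HM; rewrite pair_big_dep /=.
rewrite (partition_big (fun q => overlap q.1 q.2) predT) //=.
apply: (@le_trans _ _ (\sum_(g : {ffun T -> T + T}) M)); last by rewrite sumr_const -[leLHS]mulr_natl.
apply: ler_sum => g _.
pose A := [set q | [&& q.1 \in embeddings n E, q.2 \in embeddings n E,
  ~~ [disjoint edge_image q.1 E & edge_image q.2 E] & overlap q.1 q.2 == g]].
rewrite (eq_bigl (fun q => q \in A)); last by move=> q; rewrite [in RHS]inE -!andbA.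
have [->|[q0]] := set_0Vmem A; first by rewrite big_set0.
rewrite inE => /and4P[q1 q2 nd /eqP gE].
rewrite (eq_bigr (fun=> p ^+ #|overlap_edges g|)); last first.
  by move=> q; rewrite inE => /and4P[h1 h2 _ /eqP <-]; rewrite card_overlap_edges.
rewrite sumr_const -[leLHS]mulr_natl.
have := overlapP q1 q2 nd; rewrite gE => /HM /(_ _)/(le_trans _); apply; last first.
  by rewrite -gE => s; apply: overlap_edges2.
rewrite ler_wpM2r ?exprn_ge0 // ler_nat; apply: card_pairs_overlap_le => q.
by rewrite inE => /and4P[h1 h2 _ /eqP].
Qed.

End Overlaps.

Lemma sum_copies_le (R : realType) (T : finType) (e : rel T) n (p : R) : 0 <= p ->
  \sum_(H in copies e n) \sum_(H' in copies e n | ~~ [disjoint H.2 & H'.2]) p ^+ #|H.2 :|: H'.2|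
  <= \sum_(f in embeddings n (edgesF e))
       \sum_(f' in embeddings n (edgesF e) | ~~ [disjoint edge_image f (edgesF e) & edge_image f' (edgesF e)])
         p ^+ #|edge_image f (edgesF e) :|: edge_image f' (edgesF e)|.
Proof.
move=> p0; apply: le_trans (sum_imset_le _ _ _) _ => [H|]; first by apply: sumr_ge0 => ? _; rewrite exprn_ge0.
apply: ler_sum => f _; rewrite big_mkcondr /= [leRHS]big_mkcondr /=.
apply: le_trans (sum_imset_le _ _ _) _ => [H|//].
by case: ifP; rewrite ?exprn_ge0.
Qed.

(** * The threshold *)

Lemma exists_isqrt n : (0 < n)%N -> exists s, [/\ (0 < s)%N, (s ^ 2 <= n)%N & (n <= 4 * s ^ 2)%N].
Proof.
move=> n0; suff [s /andP[sn ns]] : exists s, (s ^ 2 <= n < s.+1 ^ 2)%N.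
  have s0 : (0 < s)%N by case: s sn ns => //; lia.
  by exists s; split => //; nia.
elim: n {n0} => [|n [s /andP[sn ns]]]; first by exists 0%N.
have [h|h] := ltnP n.+1 (s.+1 ^ 2); first by exists s; rewrite h andbT; lia.
by exists s.+1; rewrite h /=; nia.
Qed.

(** * The number of vertices *)

Section VertexCount.
Variable n : nat.

Lemma card_Vdg : #|Vdg n| = Nn n.
Proof.
rewrite /Nn -[X in 'C(X, _)](card_ord n) -card_draws.
pose h (x : cube n) := [set i | x i]; have hK : cancel h (fun A : {set 'I_n} => [ffun i => i \in A]).
  by move=> x; apply/ffunP => i; rewrite ffunE inE.
have hK' : cancel (fun A : {set 'I_n} => [ffun i => i \in A]) h.
  by move=> A; apply/setP => i; rewrite inE ffunE.
rewrite -(card_imset _ (can_inj hK)); apply: eq_card => A.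
apply/imsetP/idP => [[x]|]; first by rewrite !inE => xA ->.
by rewrite inE => cA; exists [ffun i => i \in A]; rewrite ?hK' // inE -[[set i | _]]/(h _) hK'.
Qed.

(** Through the one-vertex graph the general embedding bounds also give the order of N, without
    Stirling's formula. *)
Lemma card_embeddings_unit : #|embeddings n (finset.set0 : {set {set unit}})| = Nn n.
Proof.
rewrite -card_Vdg -(card_imset _ (_ : injective (fun x : cube n => [ffun _ : unit => x]))); last first.
  by move=> x y /ffunP /(_ tt); rewrite !ffunE.
apply: eq_card => f; apply/idP/imsetP => [|[x xV ->]].
  rewrite inE => /and3P[_ /forallP fV _]; exists (f tt) => //.
  by apply/ffunP => -[]; rewrite ffunE.
rewrite inE; apply/and3P; split; first by apply/injectiveP => -[] [].
- by apply/forallP => u; rewrite ffunE.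
- by rewrite /edge_image imset0 sub0set.
Qed.

Lemma Nn_le_expn : (Nn n <= 2 ^ n)%N.
Proof.
rewrite -card_Vdg; apply: leq_trans (max_card _) _.
by rewrite card_ffun card_bool card_ord.
Qed.

End VertexCount.

Lemma central_binomial_ge m : (2 ^ m <= 'C(2 * m, m))%N.
Proof.
elim: m => // m IHm; rewrite expnS; apply: leq_trans (leq_mul (leqnn 2) IHm) _.
rewrite mulnS !add2n binS.
have -> : 'C((2 * m).+1, m.+1) = 'C((2 * m).+1, m) by rewrite -bin_sub; [congr 'C(_, _); lia | lia].
rewrite mul2n -addnn leq_add //; case: (m) => // m'.
  by rewrite binS leq_addr.
by rewrite binS leq_addr.
Qed.

Lemma Nn_ge_expn k : (2 ^ (2 * k) <= Nn (4 * k))%N.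
Proof.
rewrite /Nn (_ : (4 * k)%N = (2 * (2 * k))%N) ?mulKn; [exact: central_binomial_ge | by [] | lia].
Qed.

(** * Orders of magnitude of N and of the threshold *)

Section Scales.
Variable R : realType.

Definition tuple_scale (n s : nat) : R := 2 ^+ n / s%:R.

Lemma tuple_scale_ge1 n s : (0 < s)%N -> (s ^ 2 <= n)%N -> 1 <= tuple_scale n s.
Proof.
move=> s0 sn; rewrite ler_pdivlMr ?ltr0n // mul1r -natrX ler_nat.
by apply: leq_trans (ltnW (ltn_expl n (isT : 1 < 2)%N)); nia.
Qed.

Lemma Nn_scale : exists C : R, 1 <= C /\ exists n0 : nat,
  forall k s : nat, (n0 <= 4 * k)%N -> (0 < s)%N -> (s ^ 2 <= 4 * k)%N -> (4 * k <= 4 * s ^ 2)%N ->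
  (Nn (4 * k))%:R <= C * tuple_scale (4 * k) s /\ tuple_scale (4 * k) s <= C * (Nn (4 * k))%:R.
Proof.
have E2 : forall s, s \in (finset.set0 : {set {set unit}}) -> #|s| = 2%N by move=> s; rewrite inE.
have [C [C0 [n0 H]]] := card_embeddings_le R E2.
have [C' [C'0 [n0' H']]] := card_embeddings_ge R E2.
exists (1 + C + C'); split; first by rewrite -addrA lerDl addr_ge0 ?ltW.
exists (n0 + n0')%N => k s n0k s0 sn ns; have sR : 0 < s%:R :> R by rewrite ltr0n.
have N0 : 0 <= (Nn (4 * k))%:R :> R := ler0n _ _.
have X1 := tuple_scale_ge1 s0 sn.
have := H (4 * k)%N s; have := H' k s.
rewrite !card_embeddings_unit card_unit cards0 !expr1 => h' h; split.
  have : (Nn (4 * k))%:R <= C * tuple_scale (4 * k) s.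
    rewrite /tuple_scale mulrA ler_pdivlMr //; apply: h => //; lia.
  nra.
have : tuple_scale (4 * k) s <= C' * (Nn (4 * k))%:R.
  rewrite /tuple_scale ler_pdivrMr //; apply: h' => //; lia.
nra.
Qed.

(** From 2^(n/2) <= N <= 2^n and 1/2 <= ln 2 <= 1, the value ln N lies between (s/2)^2 and
    (2s)^2. *)
Lemma sqrt_ln_Nn k s : (0 < k)%N -> (0 < s)%N -> (s ^ 2 <= 4 * k)%N -> (4 * k <= 4 * s ^ 2)%N ->
  s%:R <= 2 * Num.sqrt (ln (Nn (4 * k))%:R : R) /\ Num.sqrt (ln (Nn (4 * k))%:R : R) <= 2 * s%:R.
Proof.
move=> k0 s0 sn ns; set N : R := (Nn _)%:R.
have ln2ge : 2^-1 <= ln 2 :> R.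
  have := @le_ln1Dx R (- 2^-1); rewrite (_ : 1 + - 2^-1 = 2^-1) ?lnV ?posrE //; [lra | lra].
have ln2le : ln 2 <= 1 :> R by have := @le_ln1Dx R 1; rewrite -[1 + 1]/2; apply; lra.
have Nge : 2 ^+ (2 * k) <= N by rewrite -natrX ler_nat Nn_ge_expn.
have Nle : N <= 2 ^+ (4 * k) by rewrite -natrX ler_nat Nn_le_expn.
have N0 : 0 < N by apply: lt_le_trans Nge; rewrite exprn_gt0.
have lnge : (s%:R / 2) ^+ 2 <= ln N.
  apply: (@le_trans _ _ (ln (2 ^+ (2 * k)))); last by rewrite ler_ln ?posrE ?exprn_gt0.
  rewrite lnXn // -[ln 2 *+ _]mulr_natl; apply: (@le_trans _ _ ((2 * k)%:R * 2^-1)); last by rewrite ler_wpM2l.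
  have : (s ^ 2)%:R <= (4 * k)%:R :> R by rewrite ler_nat.
  by rewrite natrX !natrM; lra.
have lnle : ln N <= (2 * s%:R) ^+ 2.
  apply: (@le_trans _ _ (ln (2 ^+ (4 * k)))); first by rewrite ler_ln ?posrE ?exprn_gt0.
  rewrite lnXn // -[ln 2 *+ _]mulr_natl; apply: (@le_trans _ _ (4 * k)%:R); first by rewrite ler_piMr.
  by have := ns; rewrite -(ler_nat R) (natrM _ 4 (s ^ 2)) natrX; lra.
split.
  have /ler_wsqrtr := lnge; rewrite sqrtr_sqr ger0_norm; last by rewrite divr_ge0.
  lra.
by have /ler_wsqrtr := lnle; rewrite sqrtr_sqr ger0_norm // mulr_ge0.
Qed.

Variables (T : finType) (e : rel T).
Hypothesis rho_gt0 : 0 < rho_max e R.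
Let r : R := (rho_max e R)^-1.

(** Let X be [tuple_scale]. As N and X agree up to a factor C, the product X^r N^(-r) is bounded
    above and below, and the factor sqrt(ln N), of order [s], remains. *)
Lemma pstar_scale : exists C : R, 1 <= C /\ exists k0 : nat, forall k : nat, (k0 <= k)%N ->
  exists s : nat, [/\ [/\ (0 < s)%N, (s ^ 2 <= 4 * k)%N & (4 * k <= 4 * s ^ 2)%N],
    0 < pstar R e (4 * k),
    s%:R <= C * (tuple_scale (4 * k) s `^ r * pstar R e (4 * k)) &
    tuple_scale (4 * k) s `^ r * pstar R e (4 * k) <= C * s%:R].
Proof.
have r0 : 0 < r by rewrite invr_gt0.
have [C [C1 [n0 H]]] := Nn_scale.
have C0 : 0 < C by apply: lt_le_trans C1.
have Cr0 : 0 < C `^ r by rewrite powR_gt0.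
exists (1 + 2 * C `^ r); split; first by rewrite lerDl mulr_ge0 // powR_ge0.
exists (n0 + 1)%N => k k0.
have k_gt0 : (0 < k)%N by lia.
have [|s [s0 sn ns]] := @exists_isqrt (4 * k); first by lia.
have sR : 0 < s%:R :> R by rewrite ltr0n.
exists s; have [] := H k s _ s0 sn ns; first by lia.
have := tuple_scale_ge1 s0 sn; set X := tuple_scale _ _ => X1 NX XN.
have X0 : 0 < X by apply: lt_le_trans X1.
have [sl ls] := sqrt_ln_Nn k_gt0 s0 sn ns.
rewrite /pstar -/r; set L := Num.sqrt _ in sl ls *; set N : R := (Nn _)%:R in NX XN *.
have N0 : 0 < N.
  by rewrite ltr0n; apply: leq_trans (Nn_ge_expn k); rewrite expn_gt0.
have L0 : 0 < L by lra.
have Nr0 : 0 < N `^ r by rewrite powR_gt0.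
have Xr0 : 0 < X `^ r by rewrite powR_gt0.
have NXr : N `^ r <= C `^ r * X `^ r.
  rewrite -powRM; [|exact: ltW..].
  by apply: (ge0_ler_powR (ltW r0)); rewrite ?nnegrE ?mulr_ge0 // ltW.
have XNr : X `^ r <= C `^ r * N `^ r.
  rewrite -powRM; [|exact: ltW..].
  by apply: (ge0_ler_powR (ltW r0)); rewrite ?nnegrE ?mulr_ge0 // ltW.
rewrite powRN; split => //.
- by rewrite mulr_gt0 // invr_gt0.
- have h : 1 <= C `^ r * (X `^ r * (N `^ r)^-1) by rewrite !mulrA ler_pdivlMr // mul1r.
  rewrite [X `^ r * _]mulrA; have q0 : 0 < X `^ r / N `^ r by rewrite divr_gt0.
  have : L <= C `^ r * (X `^ r / N `^ r) * L by rewrite ler_peMl ?(ltW L0).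
  by have := mulr_gt0 q0 L0; move: (X `^ r / N `^ r) => q; lra.
- rewrite mulrA; have h : X `^ r / N `^ r <= C `^ r by rewrite ler_pdivrMr.
  have q0 : 0 < X `^ r / N `^ r by rewrite divr_gt0.
  nra.
Qed.

End Scales.

Section MaximalDensity.
Variables (R : realType) (T : finType) (e : rel T).
Hypothesis e_ne : exists a b, e a b.

Lemma rho_max_ge H : subgraphF e H -> (#|H.2|)%:R / (#|H.1|)%:R <= rho_max e R.
Proof. by move=> HF; apply: (le_bigmax_cond _ (fun H : {set T} * {set {set T}} => #|H.2|%:R / #|H.1|%:R : R)). Qed.

(** A single edge has positive density, so a densest subgraph has at least one edge. *)
Lemma rho_max_attained : exists H, [/\ subgraphF e H, (0 < #|H.2|)%N &
  rho_max e R = (#|H.2|)%:R / (#|H.1|)%:R].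
Proof.
have [a [b ab]] := e_ne; pose s := [set a; b].
have sE : s \in edgesF e by rewrite inE; apply/existsP; exists a; apply/existsP; exists b; rewrite ab eqxx.
have F0 : subgraphF e (s, [set s]).
  apply/and3P; split => /=; first by rewrite card_gt0; apply/set0Pn; exists a; rewrite !inE eqxx.
    by rewrite sub1set.
  by apply/forall_inP => t; rewrite inE => /eqP ->.
have [H HF HE] := @eq_bigmax _ _ _ 0 (s, [set s]) (subgraphF e)
   (fun H : {set T} * {set {set T}} => #|H.2|%:R / #|H.1|%:R : R) F0 (fun H _ => divr_ge0 (ler0n _ _) (ler0n _ _)).
exists H; split => //.
rewrite lt0n; apply/eqP => H0.
have := rho_max_ge F0; rewrite /rho_max HE H0 mul0r /= cards1 leNgt divr_gt0 ?ltr0n //.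
by case/and3P: F0.
Qed.

Lemma rho_max_gt0 : 0 < rho_max e R.
Proof.
have [H [/and3P[H1 _ _] H2 ->]] := rho_max_attained.
by rewrite divr_gt0 // ltr0n.
Qed.

End MaximalDensity.

(** * First and second moment bounds *)

Section Moments.
Variables (R : realType) (T : finType) (e : rel T).
Hypotheses (e_irr : irreflexive e) (e_ne : exists a b, e a b).
Let E := edgesF e.
Let rho : R := rho_max e R.

Let E2 : forall s, s \in E -> #|s| = 2%N := edgesF2 e_irr.
Let rho0 : 0 < rho := rho_max_gt0 R e_ne.

Lemma powR_expr_ratio (X : R) (a b : nat) : 0 <= X -> (0 < b)%N ->
  (X `^ (a%:R / b%:R)) ^+ b = X ^+ a.
Proof.
move=> X0 b0; rewrite -powR_mulrn ?powR_ge0 // -powRrM divfK ?powR_mulrn //.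
by rewrite pnatr_eq0 -lt0n.
Qed.

(** Puts the expected count in the form X^v (p/s)^e, the discrete version of N^v (p / sqrt(ln
    N))^e. *)
Lemma scaled_embeddings_le (Y : finType) (D : {set {set Y}}) (C p : R) n s : 0 <= p -> (0 < s)%N ->
  (#|embeddings n D|)%:R * s%:R ^+ (#|Y| + #|D|) <= C * (2 ^+ n) ^+ #|Y| ->
  (#|embeddings n D|)%:R * p ^+ #|D| <= C * tuple_scale R n s ^+ #|Y| * (p / s%:R) ^+ #|D|.
Proof.
move=> p0 s0 h; have sR : 0 < s%:R :> R by rewrite ltr0n.
have gen (a b c d : R) : C * (a / b) * (c / d) = C * a * c / (b * d) by rewrite invfM; ring.
rewrite /tuple_scale !expr_div_n gen -exprD.
rewrite ler_pdivlMr ?exprn_gt0 // mulrAC ler_wpM2r // exprn_ge0 //.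
Qed.

Lemma first_moment_bound : exists C : R, 0 < C /\ exists k0 : nat,
  forall (k : nat) (p : R), (k0 <= k)%N -> 0 <= p <= 1 -> p <= pstar R e (4 * k) ->
  PrG (4 * k) p (fun S => contains_copy e S) <= C * (p / pstar R e (4 * k)).
Proof.
have [H [HF H2 rhoE]] := rho_max_attained R e_ne; case/and3P: (HF) => H1 H2E /forall_inP H21.
pose D := sub_edges H.1 H.2.
have D2 : forall s, s \in D -> #|s| = 2%N.
  by apply: sub_edges2 => s sH; apply/E2/(fintype.subsetP H2E).
have [C [C0 [n0 U]]] := card_embeddings_le R D2.
have [C1 [C11 [k0 S]]] := pstar_scale rho0.
have C10 : 0 < C1 by apply: lt_le_trans C11.
exists (C * C1 ^+ #|H.2|); split; first by rewrite mulr_gt0 ?exprn_gt0.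
exists (n0 + k0)%N => k p kk p01 pp.
have n0n : (n0 <= 4 * k)%N by clear -kk; lia.
have /andP[p0 p1] := p01.
have [|s [[s0 sn ns] ps0 _ ps]] := S k; first by clear -kk; lia.
set n := (4 * k)%N in n0n sn ns ps0 ps pp *; clearbody n; set ps_ := pstar R e n in ps0 ps pp *.
have sR : 0 < s%:R :> R by rewrite ltr0n.
have X1 := tuple_scale_ge1 R s0 sn; set X := tuple_scale R n s in ps X1.
have X0 : 0 <= X by apply: le_trans X1.
have := U n s n0n sn; rewrite card_sub_vertex card_sub_edges; last by [].
move=> h.
have hE : (#|embeddings n D|)%:R * p ^+ #|H.2| <= C * X ^+ #|H.1| * (p / s%:R) ^+ #|H.2|.
  have := @scaled_embeddings_le _ D C p n s p0 s0.
  by rewrite card_sub_vertex card_sub_edges //; apply.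
apply: (@le_trans _ _ (#|embeddings n D|%:R * p ^+ #|H.2|)).
  rewrite mulr_natl -sumr_const.
  rewrite (eq_bigr (fun f : {ffun _} => p ^+ #|edge_image f D|)); last first.
    move=> f; rewrite inE => /and3P[/injectiveP finj _ _].
    by rewrite card_imset ?card_sub_edges //; apply: imset_inj.
  apply: PrG_union_bound => // [f|A AE]; first by rewrite inE => /and3P[].
  case/existsP=> Hc /(is_copyP e Hc AE) [f [fE HcE HcA]].
  move: fE; rewrite inE => /and3P[/injectiveP finj /forallP fV fE].
  exists [ffun u : sub_vertex H.1 => f (val u)].
    apply: sub_embedding => //; first by move=> x y _ _; apply: finj.
    by apply: fintype.subset_trans fE; apply: imsetS.
  apply: fintype.subset_trans HcA; rewrite HcE /=.
  rewrite (_ : edge_image _ _ = edge_image f H.2); first exact: imsetS.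
  rewrite -(edge_image_comp H21); apply: eq_imset => t; apply: eq_imset => u.
  by rewrite ffunE.
apply: le_trans hE _.
set w := p / ps_.
have w0 : 0 <= w by rewrite divr_ge0 // ltW.
have w1 : w <= 1 by rewrite ler_pdivrMr // mul1r.
have XE : (X `^ rho^-1) ^+ #|H.2| = X ^+ #|H.1|.
  by rewrite /rho rhoE invf_div powR_expr_ratio.
rewrite -mulrA -mulrA ler_wpM2l ?(ltW C0) // -XE -exprMn.
apply: (@le_trans _ _ ((C1 * w) ^+ #|H.2|)).
  apply: lerXn2r; rewrite ?nnegrE.
  - by rewrite mulr_ge0 ?powR_ge0 // divr_ge0.
  - exact: mulr_ge0 (ltW C10) w0.
  have -> : p = w * ps_ by rewrite /w divfK // gt_eqF.
  rewrite mulrA ler_pdivrMr // mulrCA [C1 * w]mulrC -[w * C1 * _]mulrA.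
  by rewrite ler_wpM2l.
rewrite exprMn ler_wpM2l ?exprn_ge0 ?(ltW C10) //.
by case: (#|H.2|) H2 => // b _; rewrite exprS ler_piMr // exprn_ile1.
Qed.

Lemma second_moment_bound (eps : R) : 0 < eps -> exists C : R, 0 < C /\ exists k0 : nat,
  forall (k : nat) (p : R), (k0 <= k)%N -> 0 <= p <= 1 -> pstar R e (4 * k) <= p ->
  1 - C * (pstar R e (4 * k) / p) <=
  PrG (4 * k) p (fun S => `| (XF e S)%:R / EG (4 * k) p (fun S' => (XF e S')%:R) - 1 | < eps).
Proof.
move=> eps0.
pose D (g : {ffun T -> T + T}) := sub_edges (overlap_vertices g) (overlap_edges E g).
have [Cg [Cg0 [ng Ug]]] : exists Cg : R, 0 < Cg /\ exists ng : nat, forall g n s,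
    (forall t, t \in overlap_edges E g -> #|t| = 2%N) -> (ng <= n)%N -> (s ^ 2 <= n)%N ->
    (#|embeddings n (D g)|)%:R * s%:R ^+ (#|overlap_vertices g| + #|overlap_edges E g|)
      <= Cg * (2 ^+ n) ^+ #|overlap_vertices g|.
  have : forall g : {ffun T -> T + T}, exists Cn : R * nat, 0 < Cn.1 /\ forall n s,
    (forall t, t \in overlap_edges E g -> #|t| = 2%N) -> (Cn.2 <= n)%N -> (s ^ 2 <= n)%N ->
    (#|embeddings n (D g)|)%:R * s%:R ^+ (#|overlap_vertices g| + #|overlap_edges E g|)
      <= Cn.1 * (2 ^+ n) ^+ #|overlap_vertices g|.
    (* If some edge of the pattern is degenerate, the claim is vacuous and [(1, 0)] is a default. *)
    move=> g; have [t2|nt2] := pselect (forall t, t \in overlap_edges E g -> #|t| = 2%N); last first.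
      by exists (1, 0%N).
    have [C [C0 [n0 H]]] := card_embeddings_le R (sub_edges2 (W := overlap_vertices g) t2).
    exists (C, n0); split => // n s _ n0n sn; have := H n s n0n sn.
    by rewrite card_sub_vertex card_sub_edges //; apply: overlap_edges_sub.
  move=> /fin_all_exists[Cn HC].
  exists (1 + \sum_g (Cn g).1); split.
    by rewrite ltr_wpDr // sumr_ge0 // => g _; case: (HC g) => /ltW.
  exists (\sum_g (Cn g).2)%N => g n s t2 gn sn.
  apply: le_trans ((HC g).2 n s t2 _ sn) _; first by apply: leq_trans gn; rewrite (bigD1 g) //= leq_addr.
  rewrite ler_wpM2r ?exprn_ge0 // (bigD1 g) //= addrCA lerDl addr_ge0 // sumr_ge0 // => h _.
  by case: (HC h) => /ltW.
have [C2 [C20 [n2 L]]] := card_embeddings_ge R E2.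
have [C1 [C11 [k0 S]]] := pstar_scale rho0.
have C10 : 0 < C1 by apply: lt_le_trans C11.
pose vv : R := (#|T| ^ #|T|)%:R; have vv0 : 0 < vv.
  by rewrite ltr0n expn_gt0; have [a _] := e_ne; rewrite (_ : (0 < #|T|)%N) //; apply/card_gt0P; exists a.
(* [Cg] bounds the count of unions, C1^(2 #|E|) dominates C1^#|J.2| because [1 <= C1], and [C2 * vv]
   comes, once per copy, from the lower bound on [mu]. *)
pose B : R := Cg * C1 ^+ (2 * #|E|) * (C2 * vv) ^+ 2.
have B0 : 0 < B by rewrite !mulr_gt0 ?exprn_gt0 ?mulr_gt0.
pose F : R := (#|{ffun T -> T + T}|)%:R.
have F0 : 0 < F by rewrite ltr0n; apply/card_gt0P; exists [ffun a => inl a].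
exists (F * B / eps ^+ 2); split; first by rewrite divr_gt0 ?mulr_gt0 ?exprn_gt0.
exists (ng + n2 + k0)%N => k p kk p01 pp.
have ngn : (ng <= 4 * k)%N by clear -kk; lia.
have n2n : (n2 <= 4 * k)%N by clear -kk; lia.
have /andP[p0 p1] := p01.
have [|s [[s0 sn ns] ps0 ps _]] := S k; first by clear -kk; lia.
have Ln := L k s n2n sn ns; set n := (4 * k)%N in ngn sn ns ps0 ps pp Ln *; clearbody n; set ps_ := pstar R e n in ps0 ps pp *.
have sR : 0 < s%:R :> R by rewrite ltr0n.
have X1 := tuple_scale_ge1 R s0 sn; set X := tuple_scale R n s in ps X1.
have X0 : 0 < X by apply: lt_le_trans X1.
have pgt0 : 0 < p by apply: lt_le_trans pp.
set u := p / s%:R; have u0 : 0 < u by rewrite divr_gt0.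
set mu : R := (#|copies e n|)%:R * p ^+ #|E|.
have emb_cop : (#|embeddings n E|)%:R <= vv * (#|copies e n|)%:R :> R.
  by rewrite -natrM ler_nat card_copies_ge.
have muge : X ^+ #|T| * u ^+ #|E| <= (C2 * vv) * mu.
  have gen (a b c d : R) : a / b * (c / d) = a * c / (b * d) by rewrite invfM; ring.
  rewrite /X /u /tuple_scale !expr_div_n gen -exprD ler_pdivrMr ?exprn_gt0 //.
  have gen' (a b c q : R) : C2 * a * (b * c) * q = C2 * (a * b) * q * c by ring.
  rewrite gen'.
  rewrite ler_wpM2r ?exprn_ge0 //; apply: le_trans Ln _.
  by rewrite ler_wpM2r ?exprn_ge0 // ler_wpM2l // ltW.
have lhs0 : 0 < X ^+ #|T| * u ^+ #|E| by rewrite mulr_gt0 ?exprn_gt0.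
have mu0 : 0 < mu.
  by rewrite -(pmulr_rgt0 _ (mulr_gt0 C20 vv0)); apply: lt_le_trans muge.
have cop0 : (0 < #|copies e n|)%N.
  by rewrite -(ltr0n R) -(pmulr_lgt0 _ (exprn_gt0 #|E| pgt0)).
pose M := B * (ps_ / p) * mu ^+ 2.
have w0 : 0 <= ps_ / p by rewrite divr_ge0 // ltW.
have M0 : 0 <= M := mulr_ge0 (mulr_ge0 (ltW B0) w0) (exprn_ge0 2 (ltW mu0)).
have em0 : 0 < eps ^+ 2 * mu ^+ 2 := mulr_gt0 (exprn_gt0 2 eps0) (exprn_gt0 2 mu0).
apply: le_trans (PrG_concentration p01 (fun H HC => (copiesP HC).1) (fun H HC => (copiesP HC).2)
   (@XF_copies T e n) eps0 pgt0 cop0).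
rewrite lerD2l lerN2 -/E -/mu ler_pdivrMr //.
apply: le_trans (sum_copies_le _ _ p0) _.
apply: (@le_trans _ _ (F * M)); last first.
  have gen (a b c d q : R) : a * b / c * d * (c * q) = a * (b * d * q) * (c / c) by ring.
  rewrite gen -/M.
  by rewrite divff ?mulr1 // expf_neq0 // gt_eqF.
apply: sum_overlapping_pairs_le => // g J [J2E J20 J21 cW cD] t2.
have hE : (#|embeddings n (D g)|)%:R * p ^+ #|overlap_edges E g| <=
    Cg * X ^+ #|overlap_vertices g| * u ^+ #|overlap_edges E g|.
  have := @scaled_embeddings_le _ (D g) Cg p n s p0 s0.
  rewrite card_sub_vertex card_sub_edges; last by apply: overlap_edges_sub.
  by apply; apply: Ug.
apply: le_trans hE _.
have J2gt0 : (0 < #|J.2|)%N by rewrite card_gt0.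
have JF : subgraphF e J.
  apply/and3P; split => //; last exact/forall_inP.
  case/set0Pn: J20 => t tJ; apply: leq_trans (subset_leq_card (J21 t tJ)).
  by rewrite E2 // (fintype.subsetP J2E).
have J1gt0 : (0 < #|J.1|)%N by case/and3P: JF.
have dens : (#|J.2|)%:R * rho^-1 <= (#|J.1|)%:R.
  by have := rho_max_ge R JF; rewrite -/rho ler_pdivrMr ?ltr0n // ler_pdivrMr // mulrC.
have Xu : p / ps_ <= C1 ^+ (2 * #|E|) * (X ^+ #|J.1| * u ^+ #|J.2|).
  set y := p / ps_; have y1 : 1 <= y by rewrite ler_pdivlMr // mul1r.
  have yu : y <= C1 * (X `^ rho^-1 * u).
    have gen (a b c d q : R) : a * (b * (c / d)) * q = c * (a * (b * q)) / d by ring.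
    by rewrite /y ler_pdivrMr // /u gen ler_pdivlMr // ler_wpM2l.
  have yJ : y <= y ^+ #|J.2| by apply: ler_eXnr.
  apply: le_trans yJ _; apply: (@le_trans _ _ ((C1 * (X `^ rho^-1 * u)) ^+ #|J.2|)).
    apply: lerXn2r; rewrite ?nnegrE //; first exact: le_trans ler01 y1.
    exact: mulr_ge0 (ltW C10) (mulr_ge0 (powR_ge0 _ _) (ltW u0)).
  have uJ0 := exprn_ge0 #|J.2| (ltW u0).
  rewrite exprMn [(X `^ _ * u) ^+ _]exprMn; apply: ler_pM.
  - by rewrite exprn_ge0 // ltW.
  - by rewrite mulr_ge0 // exprn_ge0 // powR_ge0.
  - by rewrite ler_weXn2l // -cD leq_addl.
  rewrite ler_wpM2r // -(powR_mulrn _ (powR_ge0 _ _)) -powRrM -(powR_mulrn _ (ltW X0)).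
  by apply: ler_powR => //; rewrite mulrC.
have psp : ps_ / p * (p / ps_) = 1 by rewrite mulrA divfK ?gt_eqF // divff // gt_eqF.
rewrite /M /B.
have mu2 : (X ^+ #|T| * u ^+ #|E|) ^+ 2 <= (C2 * vv) ^+ 2 * mu ^+ 2.
  rewrite -[leRHS]exprMn; apply: lerXn2r; rewrite ?nnegrE ?(ltW lhs0) //.
  exact: mulr_ge0 (mulr_ge0 (ltW C20) (ltW vv0)) (ltW mu0).
(* The vertex and edge numbers of the union and of J add up to those of two disjoint copies. *)
have split2 : (X ^+ #|T| * u ^+ #|E|) ^+ 2 =
    (X ^+ #|overlap_vertices g| * u ^+ #|overlap_edges E g|) * (X ^+ #|J.1| * u ^+ #|J.2|).
  by rewrite exprMn -!exprM ![(_ * 2)%N]mulnC -cW -cD !exprD mulrACA.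
set Z := X ^+ #|overlap_vertices g| * u ^+ #|overlap_edges E g| in split2 *.
have Z0 : 0 <= Z := mulr_ge0 (exprn_ge0 _ (ltW X0)) (exprn_ge0 _ (ltW u0)).
rewrite -mulrA -/Z.
have gen (a b c d q : R) : a * b * c * d * q = a * (b * d * (c * q)) by ring.
rewrite gen.
rewrite ler_wpM2l ?(ltW Cg0) //.
apply: (@le_trans _ _ (C1 ^+ (2 * #|E|) * (ps_ / p) * (X ^+ #|T| * u ^+ #|E|) ^+ 2)); last first.
  by rewrite ler_wpM2l // mulr_ge0 // exprn_ge0 // ltW.
have gen' (a b c d : R) : a * b * (c * d) = c * (b * (a * d)) by ring.
rewrite split2 gen'.
by rewrite ler_peMr // -psp ler_wpM2l.
Qed.

End Moments.

Local Open Scope classical_set_scope.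

(** * Passage to the limit *)

Section Limits.
Variables (R : realType) (T : finType) (e : rel T).
Hypotheses (e_irr : irreflexive e) (e_ne : exists a b, e a b).
Variable p : nat -> R.
Hypothesis p01 : forall k, 0 <= p (4 * k.+1)%N <= 1.

Let ratio k := p (4 * k.+1)%N / pstar R e (4 * k.+1)%N.

Lemma pstar_eventually_gt0 : exists k0, forall k, (k0 <= k)%N -> 0 < pstar R e (4 * k).
Proof.
have [C [_ [k0 H]]] := pstar_scale (rho_max_gt0 R e_ne).
by exists k0 => k /H [s []].
Qed.

Lemma contains_copy_cvg0 : ratio @ \oo --> (0 : R) ->
  (fun k => PrG (4 * k.+1)%N (p (4 * k.+1)%N) (fun S => contains_copy e S)) @ \oo --> (0 : R).
Proof.
move=> rho0; have [C [C0 [k0 H]]] := first_moment_bound R e_irr e_ne.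
have [k1 ps0] := pstar_eventually_gt0.
apply/cvgrPdist_le => eps eps0.
(* The entry 1 of the minimum ensures p <= p*, as the first moment bound demands; the other makes
   that bound at most [eps]. *)
move/cvgrPdist_le : rho0 => /(_ (Num.min 1 (eps / C))).
rewrite lt_min ltr01 divr_gt0 // => /(_ isT) small.
near=> k.
have kk0 : (k0 <= k.+1)%N by apply: leqW; near: k; exact: nbhs_infty_ge.
have kk1 : (k1 <= k.+1)%N by apply: leqW; near: k; exact: nbhs_infty_ge.
have ps := ps0 _ kk1.
have : `|0 - ratio k| <= Num.min 1 (eps / C) by near: k.
rewrite sub0r normrN le_min => /andP[r1 r2].
have {r1} r1 := le_trans (ler_norm _) r1; have {r2} r2 := le_trans (ler_norm _) r2.
rewrite sub0r normrN ger0_norm ?PrG_ge0 //.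
apply: le_trans (H _ _ kk0 (p01 k) _) _; first by move: r1; rewrite ler_pdivrMr // mul1r.
by move: r2; rewrite ler_pdivlMr // mulrC.
Unshelve. all: by end_near. Qed.

Lemma concentration_cvg1 (eps : R) : ratio @ \oo --> +oo -> 0 < eps ->
  (fun k => PrG (4 * k.+1)%N (p (4 * k.+1)%N)
    (fun S => `| (XF e S)%:R / EG (4 * k.+1)%N (p (4 * k.+1)%N) (fun S' => (XF e S')%:R) - 1 | < eps))
  @ \oo --> (1 : R).
Proof.
move=> rhoy eps0; have [C [C0 [k0 H]]] := second_moment_bound e_irr e_ne eps0.
have [k1 ps0] := pstar_eventually_gt0.
apply/cvgrPdist_le => d d0.
move/cvgryPge : rhoy => /(_ (Num.max 1 (C / d))) large.
near=> k.
have kk0 : (k0 <= k.+1)%N by apply: leqW; near: k; exact: nbhs_infty_ge.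
have kk1 : (k1 <= k.+1)%N by apply: leqW; near: k; exact: nbhs_infty_ge.
have ps := ps0 _ kk1.
have : Num.max 1 (C / d) <= ratio k by near: k.
rewrite ge_max => /andP[r1 r2].
have psp : pstar R e (4 * k.+1) <= p (4 * k.+1)%N by move: r1; rewrite ler_pdivlMr // mul1r.
have p0 := lt_le_trans ps psp.
have := H _ _ kk0 (p01 k) psp; set P := PrG _ _ _ => HP.
rewrite ger0_norm ?subr_ge0 ?PrG_le1 // lerBlDr -lerBlDl.
apply: le_trans HP; rewrite lerD2l lerN2 mulrA ler_pdivrMr //.
by move: r2; rewrite ler_pdivlMr // mulrAC ler_pdivrMr // [d * _]mulrC.
Unshelve. all: by end_near. Qed.

Lemma contains_copy_cvg1 : ratio @ \oo --> +oo ->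
  (fun k => PrG (4 * k.+1)%N (p (4 * k.+1)%N) (fun S => contains_copy e S)) @ \oo --> (1 : R).
Proof.
move=> rhoy; have h0 : 0 < 2^-1 :> R by rewrite invr_gt0.
apply: squeeze_cvgr; last 2 first.
- exact: concentration_cvg1 rhoy h0.
- exact: cvg_cst.
near=> k; rewrite PrG_le1 // andbT; apply: PrG_mono => // S _.
rewrite contains_copyE lt0n; apply: contraTneq => ->.
(* With no copy the relative deviation is |0 - 1| = 1, which is not below the chosen 1/2. *)
by rewrite mul0r sub0r normrN normr1 -leNgt invf_le1 // ler1n.
Unshelve. all: by end_near. Qed.

End Limits.

Unset Implicit Arguments.

(* n ranges over positive multiples of 4: n = 4 * k.+1, k -> oo *)
Theorem theorem5 (R : realType) (T : finType) (e : rel T)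
    (e_sym : symmetric e) (e_irr : irreflexive e)
    (e_ne : exists a b : T, e a b) :
  (forall p : nat -> R,
     (forall k : nat, 0 <= p (4 * k.+1)%N <= 1) ->
     (fun k : nat => p (4 * k.+1)%N / pstar R e (4 * k.+1)%N) @ \oo --> (0 : R) ->
     (fun k : nat => PrG (4 * k.+1)%N (p (4 * k.+1)%N) (fun S => contains_copy e S)) @ \oo --> (0 : R))
  /\
  (forall p : nat -> R,
     (forall k : nat, 0 <= p (4 * k.+1)%N <= 1) ->
     (fun k : nat => p (4 * k.+1)%N / pstar R e (4 * k.+1)%N) @ \oo --> +oo ->
     ((fun k : nat => PrG (4 * k.+1)%N (p (4 * k.+1)%N) (fun S => contains_copy e S)) @ \oo --> (1 : R))
     /\
     (forall eps : R, 0 < eps ->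
        (fun k : nat =>
           PrG (4 * k.+1)%N (p (4 * k.+1)%N)
             (fun S => `| (XF e S)%:R /
                          EG (4 * k.+1)%N (p (4 * k.+1)%N) (fun S' => (XF e S')%:R) - 1 | < eps))
        @ \oo --> (1 : R))).
Proof.
split=> p p01 lim; first exact: contains_copy_cvg0.
by split=> [|eps eps0]; [exact: contains_copy_cvg1 | exact: concentration_cvg1].
Qed.
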